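(* Let $(\overline{M},J,\overline{g})$ be a complex space form of real dimension $n+p$ and of constant holomorphic sectional curvature $4c$, where $n\geq 3$. Let $M$ be an $n$-dimensional CR submanifold of maximal CR dimension in $\overline{M}$, with distinguished unit normal vector field $\xi$, and suppose that $\xi$ is parallel with respect to the normal connection $D$ of $M$, i.e. $D_X\xi=0$ for all $X$ tangent to $M$. Let $A$ be the shape operator of $M$ with respect to $\xi$, and let $R$ be the Riemannian curvature tensor of $M$. If $RA=0$ on $M$, i.e. $R_{XY}(AZ)=A(R_{XY}Z)$ for all $X,Y,Z$ tangent to $M$, then $\overline{M}$ is a Euclidean space (that is, $\overline{M}$ is flat: $c=0$).
   Context: A complex space form $(\overline{M},J,\overline{g})$ is a Kaehler manifold, with almost complex structure $J$ and metric $\overline{g}$, of constant holomorphic sectional curvature, here denoted $4c$ with $c\in\mathbb{R}$. The number $n+p$ is its real dimension. $M$ is an $n$-dimensional real submanifold of $\overline{M}$ (immersed, with the induced Riemannian metric $g$ and Levi-Civita connection $\nabla$). For $x\in M$ put $H_x(M)=JT_x(M)\cap T_x(M)$, the maximal complex subspace of $T_x(M)$. If $\dim_{\mathbb{C}}H_x(M)$ is constant over $M$, then $M$ is called a CR submanifold and this constant is its CR dimension. If $\dim_{\mathbb{C}}H_x(M)=\frac{n-1}{2}$ for every $x\in M$, then $M$ is called a CR submanifold of maximal CR dimension. In that case there is a unit vector field $\xi$ normal to $M$ such that $JT_x(M)\subset T_x(M)\oplus \mathrm{span}\{\xi_x\}$ for every $x\in M$; this $\xi$ is the distinguished normal vector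 field. With $\overline{\nabla}$ the Levi-Civita connection of $\overline{M}$ and $D$ the normal connection induced by $\overline{\nabla}$ in the normal bundle of $M$, the shape operator $A$ of $\xi$ is the symmetric endomorphism of $T(M)$ defined by the Weingarten formula $\overline{\nabla}_X\xi=-AX+D_X\xi$ for $X$ tangent to $M$. $R$ is the Riemannian curvature tensor of $(M,g)$: $R_{XY}Z=\nabla_X\nabla_YZ-\nabla_Y\nabla_XZ-\nabla_{[X,Y]}Z$. It acts on $A$ as a derivation, $(R_{XY}A)Z=R_{XY}(AZ)-A(R_{XY}Z)$, and $RA=0$ means that this vanishes for all $X,Y,Z$ tangent to $M$. *)

(* Defs.v *)
From HB Require Import structures.
From mathcomp Require Import all_boot all_order all_algebra.
From mathcomp Require Import all_classical all_reals all_analysis.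
Set Implicit Arguments.
Unset Strict Implicit.
Unset Printing Implicit Defensive.
Import Order.TTheory GRing.Theory Num.Theory.
Import numFieldNormedType.Exports.
Local Open Scope classical_set_scope.
Local Open Scope ring_scope.

(* Tensors on an n-manifold are families of components, one for each chart.
   Tangent vectors are row vectors, so the differential of a map F acts by
   v |-> v *m 'J F y, and an endomorphism E of the tangent space by
   v |-> v *m E. *)

(** * Smooth manifolds *)

(* On an open set U, f is C^(k+1) iff it is Frechet differentiable with
   x |-> df_x(v) = 'D_v f x of class C^k for every v. *)
Fixpoint Ck (R : realType) (V W : normedModType R) (k : nat)
    (U : set V) (f : V -> W) : Prop :=
  if k is k'.+1 then
    (forall x, U x -> differentiable f x) /\
    (forall v, Ck k' U (fun x => 'D_v f x))
  else forall x, U x -> {for x, continuous f}.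

Definition smooth (R : realType) (V W : normedModType R)
    (U : set V) (f : V -> W) : Prop :=
  forall k, Ck k U f.

(* Only the values of [coord] on [dom], and of [param] on [img], matter. *)
Record chart (R : realType) (n : nat) (M : topologicalType) := Chart {
  dom : set M;
  coord :> M -> 'rV[R]_n;
  param : 'rV[R]_n -> M;
  dom_open : open dom;
  img_open : open (coord @` dom);
  coordK : forall x, dom x -> param (coord x) = x;
  coord_continuous : forall x, dom x -> {for x, continuous coord};
  param_continuous : forall x, dom x -> {for coord x, continuous param}
}.

Definition img (R : realType) (n : nat) (M : topologicalType)
    (a : chart R n M) : set 'rV[R]_n := a @` dom a.

Definition transition (R : realType) (n : nat) (M : topologicalType)
    (a b : chart R n M) : 'rV[R]_n -> 'rV[R]_n := b \o param a.

Record manifold (R : realType) (n : nat) := Manifold {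
  space :> topologicalType;
  atlas : set (chart R n space);
  space_hausdorff : hausdorff_space space;
  space_second_countable : @second_countable space;
  atlas_cover : forall x, exists2 a, atlas a & dom a x;
  atlas_compatible : forall a b, atlas a -> atlas b ->
    smooth (a @` (dom a `&` dom b)) (transition a b)
}.

(** * Riemannian geometry *)

Definition inner (R : realType) (n : nat) (G : 'M[R]_n) (u v : 'rV[R]_n) : R :=
  (u *m G *m v^T) 0 0.

(* [gram a y] is the Gram matrix of the coordinate basis of the chart a at the
   point of coordinates y. *)
Record riemannian_metric (R : realType) (n : nat) (M : manifold R n) := Metric {
  gram :> chart R n M -> 'rV[R]_n -> 'M[R]_n;
  gram_smooth : forall a, atlas a -> smooth (img a) (gram a);
  gram_sym : forall a y, atlas a -> img a y -> (gram a y)^T = gram a y;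
  gram_pos : forall a y v, atlas a -> img a y ->
    v != 0 -> 0 < inner (gram a y) v v;
  gram_change : forall a b x, atlas a -> atlas b -> dom a x -> dom b x ->
    gram a (a x) = 'J (transition a b) (a x) *m gram b (b x)
                     *m ('J (transition a b) (a x))^T
}.

Section LocalGeometry.
Variables (R : realType) (n : nat) (G : 'rV[R]_n -> 'M[R]_n).
Implicit Types (X Y Z : 'rV[R]_n -> 'rV[R]_n) (y u v w : 'rV[R]_n).

(* The value at y of nabla_u v for vector fields u, v with constant components:
   by the Koszul formula, twice its inner product with a constant field w is
   u(g(v,w)) + v(g(u,w)) - w(g(u,v)). *)
Definition christoffel y u v : 'rV[R]_n :=
  (\row_k (2^-1 * (inner ('D_u G y) v (delta_mx 0 k)
                   + inner ('D_v G y) u (delta_mx 0 k)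
                   - inner ('D_(delta_mx 0 k) G y) u v)))
  *m invmx (G y).

Definition levi_civita X Y y : 'rV[R]_n :=
  'D_(X y) Y y + christoffel y (X y) (Y y).

Definition lie_bracket X Y y : 'rV[R]_n := 'D_(X y) Y y - 'D_(Y y) X y.

Definition curvature X Y Z y : 'rV[R]_n :=
  levi_civita X (levi_civita Y Z) y - levi_civita Y (levi_civita X Z) y
  - levi_civita (lie_bracket X Y) Z y.

(* R_{uv}w for tangent vectors at y, which are extended to vector fields with
   constant components; by tensoriality the extension is immaterial. *)
Definition riemann y u v w : 'rV[R]_n :=
  curvature (cst u) (cst v) (cst w) y.

Definition sectional_curvature y u v : R :=
  inner (G y) (riemann y u v v) u
  / (inner (G y) u u * inner (G y) v v - inner (G y) u v ^+ 2).

End LocalGeometry.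

Definition flat (R : realType) (n : nat) (M : manifold R n)
    (g : riemannian_metric M) : Prop :=
  forall a y, atlas a -> img a y -> forall u v w, riemann (g a) y u v w = 0.

(** * Kaehler manifolds and complex space forms *)

Record almost_complex (R : realType) (n : nat) (M : manifold R n) :=
AlmostComplex {
  acs :> chart R n M -> 'rV[R]_n -> 'M[R]_n;
  acs_smooth : forall a, atlas a -> smooth (img a) (acs a);
  acs_sq : forall a y, atlas a -> img a y -> acs a y *m acs a y = - 1%:M;
  acs_change : forall a b x, atlas a -> atlas b -> dom a x -> dom b x ->
    'J (transition a b) (a x) *m acs b (b x)
      = acs a (a x) *m 'J (transition a b) (a x)
}.

Definition hermitian (R : realType) (n : nat) (M : manifold R n)
    (J : almost_complex M) (g : riemannian_metric M) : Prop :=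
  forall a y, atlas a -> img a y -> forall u v,
    inner (g a y) (u *m J a y) (v *m J a y) = inner (g a y) u v.

Definition parallel_acs (R : realType) (n : nat) (M : manifold R n)
    (J : almost_complex M) (g : riemannian_metric M) : Prop :=
  forall a, atlas a -> forall X Y : 'rV[R]_n -> 'rV[R]_n,
    smooth (img a) X -> smooth (img a) Y -> forall y, img a y ->
    (* nabla_X (J Y) = J (nabla_X Y) *)
    levi_civita (g a) X (fun z => Y z *m J a z) y
      = levi_civita (g a) X Y y *m J a y.

Definition kaehler (R : realType) (n : nat) (M : manifold R n)
    (J : almost_complex M) (g : riemannian_metric M) : Prop :=
  hermitian J g /\ parallel_acs J g.

Definition holomorphic_sectional_curvature (R : realType) (n : nat)
    (M : manifold R n) (J : almost_complex M) (g : riemannian_metric M)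
    (k : R) : Prop :=
  forall a y, atlas a -> img a y -> forall u, u != 0 ->
    sectional_curvature (g a) y u (u *m J a y) = k.

Definition complex_space_form (R : realType) (n : nat)
    (M : manifold R n) (J : almost_complex M) (g : riemannian_metric M)
    (c : R) : Prop :=
  kaehler J g /\ holomorphic_sectional_curvature J g (4 * c).

(** * Immersed submanifolds *)

Section Submanifold.
Variables (R : realType) (m n : nat) (M : manifold R m) (N : manifold R n).
Variable f : M -> N.
Implicit Types (a : chart R m M) (b : chart R n N) (x : M).

Definition in_charts a b x : Prop :=
  [/\ atlas a, atlas b, dom a x & dom b (f x)].

Definition local_map a b : 'rV[R]_m -> 'rV[R]_n := b \o f \o param a.

Definition overlap a b : set 'rV[R]_m := a @` (dom a `&` f @^-1` dom b).

Definition smooth_map : Prop :=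
  continuous f /\
  forall a b, atlas a -> atlas b -> smooth (overlap a b) (local_map a b).

(* Its row space is the image of T_x(M) in T_{f x}(N). *)
Definition differential a b x : 'M[R]_(m, n) := 'J (local_map a b) (a x).

Definition immersion : Prop :=
  smooth_map /\ forall a b x, in_charts a b x -> row_free (differential a b x).

Definition induced_metric (g : riemannian_metric M)
    (gN : riemannian_metric N) : Prop :=
  forall a b x, in_charts a b x ->
    g a (a x) = differential a b x *m gN b (b (f x)) *m (differential a b x)^T.

Record field_along := FieldAlong {
  comp :> chart R n N -> M -> 'rV[R]_n;
  comp_smooth : forall a b, atlas a -> atlas b ->
    smooth (overlap a b) (comp b \o param a);
  comp_change : forall b b' x, atlas b -> atlas b' ->
    dom b (f x) -> dom b' (f x) ->
    comp b' x = comp b x *m 'J (transition b b') (b (f x))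
}.

Section Ambient.
Variables (J : almost_complex N) (gN : riemannian_metric N).

(* The row space of this matrix is H_x(M) = J T_x(M) :&: T_x(M). *)
Definition holomorphic_tangent a b x : 'M[R]_n :=
  (differential a b x *m J b (b (f x)) :&: differential a b x)%MS.

(* H_x(M) is J-invariant; its complex dimension is half its real dimension. *)
Definition CR_dim a b x : nat := (\rank (holomorphic_tangent a b x))./2.

Definition maximal_CR : Prop :=
  forall a b x, in_charts a b x -> (CR_dim a b x).*2.+1 = m.

Variable xi : field_along.

Definition unit_normal : Prop :=
  forall a b x, in_charts a b x ->
    inner (gN b (b (f x))) (xi b x) (xi b x) = 1 /\
    forall v, inner (gN b (b (f x))) (v *m differential a b x) (xi b x) = 0.

Definition distinguished_normal : Prop :=
  unit_normal /\
  forall a b x, in_charts a b x ->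
    (differential a b x *m J b (b (f x)) <= differential a b x + xi b x)%MS.

(* The derivative of xi along v in T_x(M), for the Levi-Civita connection
   of N. *)
Definition covariant_along a b x (v : 'rV[R]_m) : 'rV[R]_n :=
  'D_v (xi b \o param a) (a x)
  + christoffel (gN b) (b (f x)) (v *m differential a b x) (xi b x).

(* The components, in the chart a, of the orthogonal projection to T_x(M) of a
   vector w of T_{f x}(N). *)
Definition tangent_part a b x (w : 'rV[R]_n) : 'rV[R]_m :=
  let F := differential a b x in
  let G := gN b (b (f x)) in
  w *m G *m F^T *m invmx (F *m G *m F^T).

Definition normal_part a b x (w : 'rV[R]_n) : 'rV[R]_n :=
  w - tangent_part a b x w *m differential a b x.

(* Weingarten: covariant_along v = - A v + D_v xi, with A v tangent and
   D_v xi normal. *)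
Definition shape_operator a b x (v : 'rV[R]_m) : 'rV[R]_m :=
  - tangent_part a b x (covariant_along a b x v).

Definition normal_connection a b x (v : 'rV[R]_m) : 'rV[R]_n :=
  normal_part a b x (covariant_along a b x v).

Definition parallel_normal : Prop :=
  forall a b x, in_charts a b x -> forall v, normal_connection a b x v = 0.

Definition RA_zero (g : riemannian_metric M) : Prop :=
  forall a b x, in_charts a b x -> forall u v w,
    riemann (g a) (a x) u v (shape_operator a b x w)
      = shape_operator a b x (riemann (g a) (a x) u v w).

End Ambient.
End Submanifold.

(* Main.v *)
Require Import Defs.
From HB Require Import structures.
From mathcomp Require Import all_boot all_order all_algebra.
From mathcomp Require Import all_classical all_reals all_analysis.
From mathcomp Require Import perm ring lra.
Set Implicit Arguments.
Unset Strict Implicit.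
Unset Printing Implicit Defensive.
Import Order.TTheory GRing.Theory Num.Theory.
Import numFieldNormedType.Exports.
Local Open Scope classical_set_scope.
Local Open Scope ring_scope.

(** The statement is local, so everything happens in one chart of M and one
    chart of the ambient manifold, where the immersion is a smooth map phi
    between open subsets of row-vector spaces.  All the geometry is then
    expressed by one operator, the covariant derivative of vector fields along
    phi ([cov]): it is metric, torsion-free, commutes with J, and its commutators
    are the ambient curvature ([cov_compat], [cov_torsion], [cov_acs],
    [cov_curvature]).  The ambient curvature itself is an algebraic expression in
    the metric, J and c, because a tensor with the symmetries of a Kaehler
    curvature is determined by its holomorphic sectional curvatures
    ([kaehler_curv_eq0], [space_form_riemann]).

    Since n is odd, J cannot preserve a tangent space, so J xi is tangent
    ([no_odd_complex_structure], [structure_vector_exists]).  Write U = - J xi and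
    let F be the tangential part of J.  Because xi is parallel, the rest h of the
    second fundamental form, orthogonal to xi, satisfies h(X, FY) = J h(X, Y),
    whence h(X, U) = 0, and h(AX, Y) = h(X, AY) by the Ricci equation.

    Suppose c is not zero.  Through the Gauss equation, RA = 0 is a purely
    algebraic condition at each point.  The curvature R(U, Y) does not involve h,
    and the condition for it forces A = 0 or A^2 = t A + c
    ([shape_quadratic]): A has at most two eigenvalues, with product -c when
    there are two.  Then R(Z, W) vanishes for Z and W in different
    eigenspaces.  Comparing components shows that F either preserves both
    eigenspaces or exchanges them, and that in both cases it kills one of them,
    which is therefore contained in the line of U.  So at every point U is
    principal, A U = lam U, and A = mu on the orthogonal complement of U, with
    lam = mu or lam mu = -c ([structure_vector_principal]).

    What remains is the Codazzi equation.  The 1-forms theta(w) = <cov_w xi, J xi>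
    and eta(w) = <J w, xi> satisfy theta = lam eta everywhere; taking exterior
    derivatives and evaluating on a pair v, J v orthogonal to U gives
    mu^2 - c = lam mu ([codazzi_algebra]).  Together with lam = mu or
    lam mu = -c this yields c = 0 ([principal_curvatures_flat]), a contradiction.
    Finally c = 0 makes the ambient curvature vanish ([flat_space_form]). *)

(** * Algebraic curvature tensors of Kaehler type *)

Section CurvatureSymmetries.
Variables (R : realFieldType) (V : zmodType) (T : V -> V -> V -> V -> R).

Definition curvature_symmetries : Prop :=
  [/\ forall x x' y z w, T (x + x') y z w = T x y z w + T x' y z w,
      forall x y z w, T y x z w = - T x y z w,
      forall x y z w, T x y w z = - T x y z w
    & forall x y z w, T x y z w + T y z x w + T z x y w = 0].

Hypothesis Tsym : curvature_symmetries.

Lemma curv_swap12 x y z w : T y x z w = - T x y z w.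
Proof. by case: Tsym. Qed.

Lemma curv_swap34 x y z w : T x y w z = - T x y z w.
Proof. by case: Tsym. Qed.

Lemma curv_bianchi x y z w : T x y z w + T y z x w + T z x y w = 0.
Proof. by case: Tsym. Qed.

(** Adding the Bianchi identities of the four cyclic shifts of (x, y, z, w) cancels
    all terms but these two: the octahedron argument. *)
Lemma curv_pairC x y z w : T z w x y = T x y z w.
Proof.
have := curv_bianchi x y z w; have := curv_bianchi y z w x.
have := curv_bianchi z w x y; have := curv_bianchi w x y z.
have S := curv_swap12; have S' := curv_swap34.
have := S x y z w; have := S' x y z w; have := S z w x y; have := S' z w x y.
have := S x z y w; have := S' x z y w; have := S y w x z; have := S' y w x z.
have := S x w y z; have := S' x w y z; have := S y z x w; have := S' y z x w.
have := S y w z x; have := S' z x y w; have := S w x y z; have := S' w x y z.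
have := S' y w z x; have := S z x w y; have := S' y z w x; have := S' z w y x.
lra.
Qed.

Lemma curvDl x x' y z w : T (x + x') y z w = T x y z w + T x' y z w.
Proof. by case: Tsym. Qed.

Lemma curvDlr x y y' z w : T x (y + y') z w = T x y z w + T x y' z w.
Proof. by rewrite curv_swap12 curvDl opprD -!curv_swap12. Qed.

Lemma curvDrl x y z z' w : T x y (z + z') w = T x y z w + T x y z' w.
Proof. by rewrite -curv_pairC curvDl !(curv_pairC x). Qed.

Lemma curvDr x y z w w' : T x y z (w + w') = T x y z w + T x y z w'.
Proof. by rewrite curv_swap34 curvDrl opprD -!curv_swap34. Qed.

Lemma curvNl x y z w : T (- x) y z w = - T x y z w.
Proof.
apply/eqP; rewrite -addr_eq0 -curvDl addNr; apply/eqP.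
by apply: (addrI (T 0 y z w)); rewrite -curvDl !addr0.
Qed.

Lemma curvNlr x y z w : T x (- y) z w = - T x y z w.
Proof. by rewrite curv_swap12 curvNl -!curv_swap12. Qed.

Lemma curvNrl x y z w : T x y (- z) w = - T x y z w.
Proof. by rewrite -curv_pairC curvNl !(curv_pairC x). Qed.

Lemma curvNr x y z w : T x y z (- w) = - T x y z w.
Proof. by rewrite curv_swap34 curvNrl -!curv_swap34. Qed.

Definition curvE :=
  (curvDl, curvDlr, curvDrl, curvDr, curvNl, curvNlr, curvNrl, curvNr).

(** Polarizing twice makes T alternating in all four arguments, and then the three
    terms of the Bianchi identity coincide. *)
Lemma curv_eq0 : (forall x y, T x y y x = 0) -> forall x y z w, T x y z w = 0.
Proof.
move=> T0 x y z w.
have S := curv_swap12; have S' := curv_swap34.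
have P a b e : T a b e a = 0.
  have := T0 a (b + e); rewrite !curvE !T0.
  by have := curv_pairC a b e a; have := S a e b a; have := S' e a a b; lra.
have Q a b e f : T f b e a = - T a b e f.
  by have := P (a + f) b e; rewrite !curvE !P; lra.
have C a b e f : T b e a f = T a b e f.
  have := S e b a f; have := S' e b a f; have := Q e b f a.
  by have := S' a b e f; lra.
by have := curv_bianchi x y z w; rewrite (C y z x) (C x y z); lra.
Qed.

Variable J : V -> V.
Hypothesis JD : forall x y, J (x + y) = J x + J y.
Hypothesis JJ : forall x, J (J x) = - x.
Hypothesis TJ : forall x y z w, T x y (J z) (J w) = T x y z w.

(** Polarizing the hypothesis at x + y and x - y and using the Bianchi identity
    gives T x y y x + 3 T x Jy Jy x = 0; the same relation with Jy in place of y has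
    the two coefficients exchanged, so both terms vanish. *)
Lemma kaehler_curv_eq0 : (forall x, T x (J x) (J x) x = 0) ->
  forall x y z w, T x y z w = 0.
Proof.
move=> T0.
have JN x : J (- x) = - J x.
  apply/eqP; rewrite -addr_eq0 -JD addNr; apply/eqP.
  by apply: (addrI (J 0)); rewrite -JD !addr0.
have TJl x y z w : T (J x) (J y) z w = T x y z w.
  by rewrite -curv_pairC TJ curv_pairC.
have TJ' x y z w : T x y z (J w) = - T x y (J z) w.
  by rewrite -(TJ x y z) JJ curvNr.
have TJl' x y z w : T x (J y) z w = - T (J x) y z w.
  by rewrite -(TJl x) JJ curvNlr.
have H x y : T x (J x) (J y) y = - (T x (J y) (J y) x + T x (J y) (J y) x).
  have e1 a b : T b (J a) (J a) b = T a (J b) (J b) a.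
    by rewrite TJl' -TJ' curv_swap12 curv_swap34 opprK.
  have e2 a b : T a (J b) (J a) b = T a (J b) (J b) a.
    by rewrite -[LHS]opprK -TJ' -curv_swap34.
  have e4 : T y (J y) (J x) x = T x (J x) (J y) y.
    by rewrite -curv_pairC curv_swap12 curv_swap34 opprK.
  have := T0 (x + y); have := T0 (x - y); rewrite !(JD, JN) !curvE !T0.
  by have := e1 x y; have := e2 x y; have := e2 y x; lra.
apply: curv_eq0 => x y.
have B a b : T a b b a + (T a (J b) (J b) a) *+ 3 = 0.
  have := curv_bianchi a (J a) (J b) b; have := H a b.
  rewrite (curv_swap12 a (J b) (J a) b) TJl.
  rewrite [T a b a b]curv_swap34 [T a (J b) (J a) b]curv_swap34 TJ' opprK.
  by rewrite !mulrSr mulr0n; lra.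
have := B x y; have := B x (J y).
rewrite JJ !curvE opprK !mulrSr !mulr0n; lra.
Qed.

End CurvatureSymmetries.

(** * Inner products *)

Section InnerProduct.
Variables (R : realFieldType) (V : lmodType R).

Definition inner_product (g : V -> V -> R) : Prop :=
  [/\ forall x y, g x y = g y x,
      forall a x y z, g (a *: x + y) z = a * g x z + g y z
    & forall x, x != 0 -> 0 < g x x].

Variable g : V -> V -> R.
Hypothesis gP : inner_product g.

Lemma ipC x y : g x y = g y x.
Proof. by case: gP. Qed.

Lemma ipDl x y z : g (x + y) z = g x z + g y z.
Proof. by case: gP => _ gl _; rewrite -[x]scale1r gl mul1r scale1r. Qed.

Lemma ip0l z : g 0 z = 0.
Proof. by apply: (addrI (g 0 z)); rewrite -ipDl !addr0. Qed.

Lemma ipZl a x z : g (a *: x) z = a * g x z.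
Proof. by case: gP => _ gl _; rewrite -[a *: x]addr0 gl ip0l addr0. Qed.

Lemma ipNl x z : g (- x) z = - g x z.
Proof. by rewrite -scaleN1r ipZl mulN1r. Qed.

Lemma ipDr x y z : g z (x + y) = g z x + g z y.
Proof. by rewrite !(ipC z) ipDl. Qed.

Lemma ip0r z : g z 0 = 0.
Proof. by rewrite ipC ip0l. Qed.

Lemma ipZr a x z : g z (a *: x) = a * g z x.
Proof. by rewrite !(ipC z) ipZl. Qed.

Lemma ipNr x z : g z (- x) = - g z x.
Proof. by rewrite !(ipC z) ipNl. Qed.

Definition ipE := (ipDl, ip0l, ipZl, ipNl, ipDr, ip0r, ipZr, ipNr).

Lemma ip_gt0 x : x != 0 -> 0 < g x x.
Proof. by case: gP => _ _; apply. Qed.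

Lemma ip_ge0 x : 0 <= g x x.
Proof. by have [->|/ip_gt0/ltW//] := eqVneq x 0; rewrite ip0l. Qed.

Lemma ip_eq0 x : g x x = 0 -> x = 0.
Proof. by apply: contra_eq => /ip_gt0; rewrite lt0r => /andP[]. Qed.

Lemma ip_nondeg x : (forall y, g x y = 0) -> x = 0.
Proof. by move=> /(_ x)/ip_eq0. Qed.

Lemma ip_inj x y : (forall z, g x z = g y z) -> x = y.
Proof.
move=> xy; apply/eqP; rewrite -subr_eq0; apply/eqP/ip_nondeg => z.
by rewrite ipDl ipNl xy subrr.
Qed.

End InnerProduct.

Section ConstantHolomorphicCurvature.
Variables (R : realFieldType) (V : lmodType R) (g : V -> V -> R).
Variables (J : {linear V -> V}) (c : R).

Definition model_curvature (x y z w : V) : R :=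
  c * (g y z * g x w - g x z * g y w + g (J y) z * g (J x) w
       - g (J x) z * g (J y) w - 2 * g (J x) y * g (J z) w).

Hypotheses (gP : inner_product g) (JJ : forall x, J (J x) = - x).
Hypothesis gJ : forall x y, g (J x) (J y) = g x y.

Lemma ipJC x y : g (J y) x = - g (J x) y.
Proof. by rewrite -gJ JJ (ipNl gP) (ipC gP). Qed.

Lemma model_curvature_symmetries : curvature_symmetries model_curvature.
Proof.
have C := ipC gP; split=> [x x' y z w|x y z w|x y z w|x y z w];
  rewrite /model_curvature.
- by rewrite !linearD !(ipE gP); ring.
- by rewrite (ipJC x y); ring.
- by rewrite (ipJC z w); ring.
- rewrite (C y x) (C z x) (C z y) (ipJC x y) (ipJC x z) (ipJC y z).
  by ring.
Qed.

(** The difference of T and the model has the symmetries of a Kaehler curvature and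
    vanishing holomorphic sectional curvatures. *)
Lemma space_form_curvature (T : V -> V -> V -> V -> R) :
  curvature_symmetries T -> (forall x y z w, T x y (J z) (J w) = T x y z w) ->
  (forall x, T x (J x) (J x) x = 4 * c * g x x ^+ 2) ->
  T = model_curvature.
Proof.
move=> Ts TJ TH; pose D x y z w := T x y z w - model_curvature x y z w.
have Ds : curvature_symmetries D.
  have [a1 a2 a3 a4] := Ts; have [b1 b2 b3 b4] := model_curvature_symmetries.
  split=> [x x' y z w|x y z w|x y z w|x y z w]; rewrite /D.
  - by rewrite a1 b1; ring.
  - by rewrite a2 b2; ring.
  - by rewrite a3 b3; ring.
  - by have := a4 x y z w; have := b4 x y z w; lra.
have D0 : forall x y z w, D x y z w = 0.
  apply: (kaehler_curv_eq0 Ds (linearD J) JJ) => [x y z w|x]; rewrite /D.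
    rewrite TJ /model_curvature !gJ.
    rewrite (ipC gP y (J z)) (ipC gP x (J w)) (ipC gP x (J z)) (ipC gP y (J w)).
    by rewrite (ipJC y z) (ipJC x w) (ipJC x z) (ipJC y w); ring.
  rewrite TH /model_curvature !gJ JJ !(ipE gP).
  have -> : g (J x) x = 0 by have := ipJC x x; lra.
  by ring.
apply/funext => x; apply/funext => y; apply/funext => z; apply/funext => w.
by have := D0 x y z w; rewrite /D; lra.
Qed.

End ConstantHolomorphicCurvature.

(** * Shape operators commuting with the curvature *)

Section CommutingShapeOperator.
Variables (R : rcfType) (V W : lmodType R) (g : V -> V -> R) (q : W -> W -> R).
Variables (F A : {linear V -> V}) (U : V) (J : {linear W -> W}) (c : R).
Variable h : V -> V -> W.

(** The right-hand side of the Gauss equation for a submanifold of a complex space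
    form: A is the shape operator of xi and h the part of the second fundamental
    form orthogonal to xi. *)
Definition gauss_curvature (x y z w : V) : R :=
  model_curvature g F c x y z w
  + (g (A y) z * g (A x) w - g (A x) z * g (A y) w)
  + (q (h y z) (h x w) - q (h x z) (h y w)).

Hypotheses (gP : inner_product g) (qP : inner_product q).
Hypotheses (Fskew : forall x y, g (F y) x = - g (F x) y) (FU : F U = 0).
Hypotheses (FF : forall x, F (F x) = - x + g x U *: U) (UU : g U U = 1).
Hypothesis Asym : forall x y, g (A x) y = g x (A y).
Hypotheses (hC : forall x y, h x y = h y x).
Hypothesis hl : forall a x y z, h (a *: x + y) z = a *: h x z + h y z.
Hypotheses (hJ : forall x y, h x (F y) = J (h x y)).
Hypothesis Jinj : forall w, J w = 0 -> w = 0.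
Hypothesis hA : forall x y, h (A x) y = h x (A y).
Hypothesis gaussA :
  forall x y z w, gauss_curvature x y (A z) w = gauss_curvature x y z (A w).
Hypothesis c_neq0 : c != 0.

Let gC := ipC gP.
Let gE := ipE gP.

Let h0l z : h 0 z = 0.
Proof.
have := hl 1 0 0 z; rewrite scaler0 addr0 scale1r => /(canLR (addrK _)).
by rewrite subrr.
Qed.

Let hD x y z : h (x + y) z = h x z + h y z.
Proof. by have := hl 1 x y z; rewrite !scale1r. Qed.

Let hZ a x z : h (a *: x) z = a *: h x z.
Proof. by have := hl a x 0 z; rewrite h0l !addr0. Qed.

Let hN x z : h (- x) z = - h x z.
Proof. by rewrite -scaleN1r hZ scaleN1r. Qed.

Lemma normal_part_structure_vector x : h x U = 0.
Proof. by apply: Jinj; rewrite -hJ FU hC h0l. Qed.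

(** This is [gaussA] for the pair (U, y) and twice the vector z, where h and F drop out
    since both vanish on U; it is linear in y, so it is an identity between
    vectors. *)
Lemma structure_vector_identity z :
  g (A U) z *: A (A z) + (c * g U z - g (A (A U)) z) *: A z
    = (c * g (A U) z) *: z.
Proof.
apply: (ip_inj gP) => y.
have := gaussA U y z z.
rewrite /gauss_curvature /model_curvature !FU !(hC U) !normal_part_structure_vector.
rewrite !gE !(ip0l qP) !(ip0r qP).
have -> : g U (A z) = g (A U) z by rewrite Asym.
have -> : g (A U) (A z) = g (A (A U)) z by rewrite (Asym (A U)).
have -> : g (A (A z)) y = g (A y) (A z) by rewrite (Asym (A z)) gC.
have -> : g y (A z) = g (A y) z by rewrite Asym.
have -> : g (A z) y = g (A y) z by rewrite Asym gC.
rewrite (gC z y); lra.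
Qed.

(** By [structure_vector_identity], for a = A U the vectors A (A z) - c z and A z are
    proportional with a ratio k z / g a z of linear forms.  If the two forms are
    proportional, the ratio is a constant t; otherwise A would have rank one with
    image spanned by a, which the identity excludes. *)
Lemma shape_quadratic :
  (forall z, A z = 0) \/ exists t, forall z, A (A z) = t *: A z + c *: z.
Proof.
have key := structure_vector_identity.
set a := A U in key *; have [a0|a0] := eqVneq a 0.
  left; have A0 z : g U z != 0 -> A z = 0.
    move=> Uz; have := key z; rewrite a0 linear0 !gE scale0r add0r subr0 mulr0.
    rewrite scale0r => /eqP; rewrite scaler_eq0 mulf_eq0 (negPf c_neq0).
    by rewrite (negPf Uz) => /eqP.
  move=> z; have [Uz|/A0//] := eqVneq (g U z) 0.
  rewrite -[z](addrK U) linearB /= -/a a0 subr0; apply: A0.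
  by rewrite !gE Uz UU add0r oner_eq0.
right; have fa : g a a != 0 by rewrite gt_eqF// ip_gt0.
pose k z := g (A a) z - c * g U z.
pose t := k a / g a a; pose m z := k z - t * g a z.
pose B z := A (A z) - t *: A z - c *: z.
have kD y z : k (y + z) = k y + k z by rewrite /k !gE; ring.
have kZ r z : k (r *: z) = r * k z by rewrite /k !gE; ring.
have mD y z : m (y + z) = m y + m z by rewrite /m kD !gE; ring.
have mZ r z : m (r *: z) = r * m z by rewrite /m kZ !gE; ring.
have ma : m a = 0 by rewrite /m /t divfK ?subrr.
have BD y z : B (y + z) = B y + B z.
  by apply: (ip_inj gP) => w; rewrite /B !linearD /= !gE; ring.
have keyB z : g a z *: B z = m z *: A z.
  apply/eqP; rewrite -subr_eq0; apply/eqP.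
  have := key z => /eqP; rewrite -subr_eq0 => /eqP <-.
  rewrite /B /m /k !scalerBr !scalerBl !scalerA /=.
  apply: (ip_inj gP) => w; rewrite !gE; ring.
have Ba : B a = 0.
  apply/eqP; have /eqP := keyB a; rewrite ma scale0r scaler_eq0 (negPf fa).
  by [].
have Bz z : g a a *: B z = m z *: A a.
  apply: (addrI (m z *: A z)); have := keyB (z + a).
  rewrite BD Ba addr0 mD ma addr0 linearD gE scalerDl keyB.
  by move=> ->; rewrite [LHS]scalerDr.
(* m measures how far k is from a multiple of the form g a. *)
suff m0 z : m z = 0.
  exists t => z; have := Bz z; rewrite m0 scale0r => /eqP.
  rewrite scaler_eq0 (negPf fa) /= /B subr_eq0 => /eqP <-.
  by rewrite addrC subrK.
apply/eqP; apply: contraT => mz0.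
have An y : m y != 0 -> g a a *: A y = g a y *: A a.
  move=> my; apply: (scalerI my); rewrite scalerA mulrC -scalerA -keyB scalerA.
  by rewrite mulrC -scalerA Bz !scalerA mulrC.
(* Where m vanishes, y is a difference of points where it does not. *)
have Aall y : g a a *: A y = g a y *: A a.
  have [my|/An//] := eqVneq (m y) 0.
  apply: (addIr (g a z *: A a)); have := An (y + z); rewrite mD my add0r => /(_ mz0).
  by rewrite linearD scalerDr gE scalerDl (An z mz0).
have [y ay my] : exists2 y, g a y = 0 & m y = g a a * m z.
  exists (g a a *: z - g a z *: a); first by rewrite !gE; ring.
  by rewrite mD -scaleNr !mZ ma mulr0 addr0.
have Aaa w : g a a * g (A a) w = g (A a) a * g a w.
  have e1 := congr1 (fun v => g v a) (Aall w).
  rewrite /= !gE in e1; rewrite [g (A a) w]Asym [g a (A w)]gC e1; ring.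
have := Bz y; rewrite /B.
have Ay0 : A y = 0.
  by apply/eqP; have /eqP := Aall y; rewrite ay scale0r scaler_eq0 (negPf fa).
rewrite Ay0 linear0 scaler0 subr0 sub0r => /(congr1 (fun v => g v y)).
rewrite /= !gE => e.
have y0 : g y y = 0.
  have : g a a * g a a * (c * g y y) = 0.
    have := Aaa y; rewrite ay mulr0 => /eqP; rewrite mulf_eq0 (negPf fa) /=.
    move=> /eqP e'; rewrite e' mulr0 in e; rewrite -mulrA.
    by move: e; rewrite mulrN => /eqP; rewrite oppr_eq0 => /eqP ->; rewrite mulr0.
  by move/eqP; rewrite !mulf_eq0 (negPf fa) (negPf c_neq0) /= => /eqP.
have := ip_eq0 gP y0 => y00.
have : m y = 0 by rewrite y00 -(scale0r 0) mZ mul0r.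
by rewrite my => /eqP; rewrite mulf_eq0 (negPf fa) (negPf mz0).
Qed.

Section Involution.
Variables (S : V -> V) (lam mu : R).
Hypotheses (SD : forall x y, S (x + y) = S x + S y) (SS : forall x, S (S x) = x).
Hypotheses (Ssym : forall x y, g (S x) y = g x (S y)).
Hypotheses (hS : forall x y, h (S x) y = h x (S y)).
Hypothesis gaussS :
  forall x y z w, gauss_curvature x y (S z) w = gauss_curvature x y z (S w).
Hypotheses (Aplus : forall x, S x = x -> A x = lam *: x).
Hypotheses (Aminus : forall x, S x = - x -> A x = mu *: x).
Hypothesis lam_mu : lam * mu = - c.

Lemma gauss_curvature_pairC x y z w :
  gauss_curvature z w x y = gauss_curvature x y z w.
Proof.
rewrite /gauss_curvature /model_curvature.
rewrite (gC w x) (gC z y) (gC z x) (gC w y) (Fskew x w) (Fskew y z).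
rewrite (Fskew x z) (Fskew y w) (hC w x) (hC z y) (hC z x) (hC w y).
rewrite (Asym w x) (Asym z y) (Asym z x) (Asym w y).
rewrite (gC w (A x)) (gC z (A y)) (gC z (A x)) (gC w (A y)).
rewrite (ipC qP (h x w)) (ipC qP (h x z)); ring.
Qed.

Lemma gauss_curvatureNl x y z w :
  gauss_curvature x (- y) z w = - gauss_curvature x y z w.
Proof.
rewrite /gauss_curvature /model_curvature !linearN !hN !gE.
by rewrite !(ipNl qP) !(ipNr qP); ring.
Qed.

Lemma eigen_orthogonal x y : S x = x -> S y = - y -> g x y = 0.
Proof.
by move=> Sx Sy; have := Ssym x y; rewrite Sx Sy !gE; lra.
Qed.

Lemma eigen_h x y : S x = x -> S y = - y -> h x y = 0.
Proof.
move=> Sx Sy; have := hS x y; rewrite Sx Sy (hC x (- y)) hN (hC y).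
move/eqP; rewrite -addr_eq0 -mulr2n -scaler_nat scaler_eq0.
by rewrite pnatr_eq0 => /eqP.
Qed.

(** S is symmetric for the curvature, so R (S x) y = R x (S y) by pair symmetry; on
    opposite eigenvectors the two sides are opposite. *)
Lemma eigen_gauss x y z w : S x = x -> S y = - y -> gauss_curvature x y z w = 0.
Proof.
move=> Sx Sy; have : gauss_curvature x y z w = - gauss_curvature x y z w.
  rewrite -gauss_curvatureNl -Sy -(gauss_curvature_pairC x y).
  by rewrite -(gauss_curvature_pairC x (S y)) -gaussS Sx.
lra.
Qed.

(** The component of R(x, y) = 0 on the pair (x, z) is -3 c times this product. *)
Lemma eigen_mixed x y z :
  S x = x -> S y = - y -> S z = z -> g (F x) y * g (F x) z = 0.
Proof.
move=> Sx Sy Sz; have := eigen_gauss x z Sx Sy.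
rewrite /gauss_curvature /model_curvature (Aplus Sx) (Aminus Sy).
rewrite (hC y) (eigen_h Sx Sy) (hC y) (eigen_h Sz Sy).
rewrite (gC y x) (gC y z) !gE (gC y x) (gC y z) !(eigen_orthogonal Sx Sy).
rewrite (eigen_orthogonal Sz Sy) (ip0l qP) (ip0r qP).
have -> : g (F y) x = - g (F x) y by rewrite Fskew.
have -> : g (F x) x = 0 by have := Fskew x x; lra.
move=> e; apply: (mulfI c_neq0); rewrite mulr0; lra.
Qed.

(** By [eigen_mixed] the plus eigenspace is the union of the two subspaces of the x
    whose image by F lies in one of the eigenspaces, hence it is one of them. *)
Lemma eigen_F_dichotomy :
  (forall x y, S x = x -> S y = - y -> g (F x) y = 0) \/
  (forall x z, S x = x -> S z = z -> g (F x) z = 0).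
Proof.
have [P|] := pselect (forall x y, S x = x -> S y = - y -> g (F x) y = 0).
  by left.
move=> /existsNP[x /existsNP[y /not_implyP[Sx /not_implyP[Sy /eqP xy]]]].
have xz z : S z = z -> g (F x) z = 0.
  by move=> Sz; have /eqP := eigen_mixed Sx Sy Sz; rewrite mulf_eq0 (negPf xy) => /eqP.
right=> x' z Sx' Sz; apply/eqP; apply: contraT => x'z.
have x'y : g (F x') y = 0.
  by have /eqP := eigen_mixed Sx' Sy Sz; rewrite mulf_eq0 (negPf x'z) orbF => /eqP.
have Sxx' : S (x + x') = x + x' by rewrite SD Sx Sx'.
have /eqP := eigen_mixed Sxx' Sy Sz; rewrite linearD !gE x'y (xz _ Sz) addr0 add0r.
by rewrite mulf_eq0 (negPf xy) (negPf x'z).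
Qed.

Lemma kernel_structure_vector x : F x = 0 -> x = g x U *: U.
Proof. by move=> Fx; apply/esym/eqP; rewrite -subr_eq0 addrC -FF Fx linear0. Qed.

(** When F preserves both eigenspaces, c times this product and a term symmetric in
    (x, w) add up to zero in R(x, y) = 0; the product is skew in (x, w). *)
Lemma eigen_block x y z w : S x = x -> S w = w -> S y = - y -> S z = - z ->
  (forall x y, S x = x -> S y = - y -> g (F x) y = 0) ->
  g (F y) z * g (F x) w = 0.
Proof.
move=> Sx Sw Sy Sz Fmix.
have id x' w' : S x' = x' -> S w' = w' ->
    c * (g (F y) z * g (F x') w') + q (h y z) (h x' w') = 0.
  move=> Sx' Sw'; have := eigen_gauss z w' Sx' Sy.
  rewrite /gauss_curvature /model_curvature (Aplus Sx') (Aminus Sy) !gE.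
  rewrite (eigen_orthogonal Sx' Sz) (gC y w') (eigen_orthogonal Sw' Sy).
  rewrite (Fmix _ _ Sx' Sz) (Fmix _ _ Sx' Sy) (eigen_h Sx' Sz) (ip0l qP).
  have := congr1 ( *%R (g y z * g x' w')) lam_mu; lra.
have e1 := id x w Sx Sw; have := id w x Sw Sx.
rewrite (hC w x) (Fskew x w) => e2.
by apply: (mulfI c_neq0); rewrite mulr0; lra.
Qed.

(** If F maps the plus eigenspace into the minus eigenspace, then
    J (h x x) = h x (F x) is h of opposite eigenvectors, so h x x = 0, and the
    sectional curvature of the plane of x and y reduces to 3 c (g (F x) y)^2. *)
Lemma eigen_swap x y : S x = x -> S y = - y ->
  (forall x z, S x = x -> S z = z -> g (F x) z = 0) -> g (F x) y = 0.
Proof.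
move=> Sx Sy Fpp.
have SF : S (F x) = - F x.
  apply/eqP; rewrite -addr_eq0; apply/eqP/(ip_nondeg gP) => z.
  rewrite gE Ssym -gE Fpp//.
  by rewrite SD SS addrC.
have hx : h x x = 0.
  by apply: Jinj; rewrite -hJ eigen_h.
have := eigen_gauss y x Sx Sy.
rewrite /gauss_curvature /model_curvature (Aplus Sx) (Aminus Sy) !gE.
rewrite (eigen_orthogonal Sx Sy) hx (eigen_h Sx Sy) !(ip0l qP) (ip0r qP).
have -> : g (F y) x = - g (F x) y by rewrite Fskew.
have -> : g (F x) x = 0 by have := Fskew x x; lra.
move=> e; have e' := congr1 ( *%R (g y y * g x x)) lam_mu.
have : c * (3 * g (F x) y ^+ 2) = 0 by lra.
by move/eqP; rewrite !mulf_eq0 (negPf c_neq0) pnatr_eq0 /= orbb => /eqP.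
Qed.

Lemma plus_in_kernel : (forall x y, S x = x -> S y = - y -> g (F x) y = 0) ->
  (forall x z, S x = x -> S z = z -> g (F x) z = 0) ->
  forall x, S x = x -> F x = 0.
Proof.
move=> Fpm Fpp x Sx; apply: (ip_nondeg gP) => z.
have two : (2 : R) != 0 by rewrite pnatr_eq0.
apply: (mulfI two); rewrite mulr0.
have -> : 2 * g (F x) z = g (F x) (z + S z) + g (F x) (z - S z).
  by rewrite !gE; ring.
rewrite Fpp ?Fpm ?addr0//; last by rewrite SD SS addrC.
have SN y : S (- y) = - S y.
  apply/eqP; rewrite -addr_eq0 -SD addNr; apply/eqP.
  by apply: (addrI (S 0)); rewrite -SD !addr0.
by rewrite SD SN SS opprB addrC.
Qed.

End Involution.

Lemma gauss_curvature_shift t r x y z w :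
  gauss_curvature x y (r *: (A z - t *: z)) w
    = gauss_curvature x y z (r *: (A w - t *: w)).
Proof.
have el a b u v : gauss_curvature x y (a *: (u - b *: v)) w
    = a * (gauss_curvature x y u w - b * gauss_curvature x y v w).
  have Fe : F (a *: (u - b *: v)) = a *: (F u - b *: F v).
    by rewrite linearZ linearB linearZ.
  rewrite /gauss_curvature /model_curvature Fe.
  rewrite !(hC y) !(hC x) !(hZ, hD, hN) !gE.
  by rewrite !(ipDl qP, ipNl qP, ipDr qP, ipNr qP, ipZl qP, ipZr qP) /=; ring.
have er a b u v : gauss_curvature x y z (a *: (u - b *: v))
    = a * (gauss_curvature x y z u - b * gauss_curvature x y z v).
  rewrite /gauss_curvature /model_curvature.
  rewrite !(hC y) !(hC x) !(hZ, hD, hN) !gE.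
  by rewrite !(ipDl qP, ipNl qP, ipDr qP, ipNr qP, ipZl qP, ipZr qP) /=; ring.
by rewrite el er gaussA.
Qed.

(** The symmetric operator B = A - t/2 has square d = t^2/4 + c, so d is nonnegative.
    If d = 0 then A is scalar; otherwise S = B / sqrt d is an involution whose
    eigenspaces are those of A, for the eigenvalues t/2 +- sqrt d of product -c. *)
Lemma structure_vector_principal : exists lam mu : R,
  [/\ A U = lam *: U, forall z, g z U = 0 -> A z = mu *: z
    & lam = mu \/ lam * mu = - c].
Proof.
have [A0|[t At]] := shape_quadratic.
  by exists 0, 0; split=> [|z _|]; rewrite ?A0 ?scale0r//; left.
pose B z := A z - (t / 2) *: z; pose d := t ^+ 2 / 4 + c.
have Bsym x y : g (B x) y = g x (B y) by rewrite /B !gE Asym; ring.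
have BB z : B (B z) = d *: z.
  rewrite /B linearB linearZ /= At.
  by apply: (ip_inj gP) => w; rewrite !gE /d; field.
have BD x y : B (x + y) = B x + B y.
  by rewrite /B linearD; apply: (ip_inj gP) => w; rewrite !gE; ring.
have d_ge0 : 0 <= d.
  by have := ip_ge0 gP (B U); rewrite Bsym BB !gE UU mulr1.
have AB z : A z = B z + (t / 2) *: z by rewrite subrK.
have BZ a z : B (a *: z) = a *: B z.
  by rewrite /B linearZ; apply: (ip_inj gP) => w; rewrite !gE; ring.
have BN z : B (- z) = - B z by rewrite -scaleN1r BZ scaleN1r.
have hB x y : h (B x) y = h x (B y).
  by rewrite /B (hC x (_ - _)) !(hD, hN, hZ) hA (hC x) (hC x y).
have gaussB r x y z w : gauss_curvature x y (r *: B z) w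
    = gauss_curvature x y z (r *: B w) by exact: gauss_curvature_shift.
clearbody B.
have [d0|d_neq0] := eqVneq d 0.
  have B0 z : B z = 0.
    by apply: (ip_eq0 gP); rewrite Bsym BB d0 scale0r !gE.
  exists (t / 2), (t / 2); split=> [|z _|]; rewrite ?AB ?B0 ?add0r//.
  by left.
pose r := Num.sqrt d.
have rr : r * r = d by rewrite -expr2 sqr_sqrtr.
have r_neq0 : r != 0 by rewrite gt_eqF// sqrtr_gt0 lt0r d_neq0.
pose S z := r^-1 *: B z.
have SN z : S (- z) = - S z by rewrite /S BN scalerN.
have SD x y : S (x + y) = S x + S y by rewrite /S BD scalerDr.
have SS z : S (S z) = z.
  by rewrite /S BZ BB !scalerA -rr (_ : _ * _ = 1) ?scale1r//; field.
have Ssym x y : g (S x) y = g x (S y) by rewrite /S !gE Bsym.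
have hS x y : h (S x) y = h x (S y).
  by rewrite /S hZ hB (hC x (_ *: _)) hZ (hC x).
have gaussS x y z w : gauss_curvature x y (S z) w = gauss_curvature x y z (S w).
  exact: gaussB.
have AS z : A z = r *: S z + (t / 2) *: z by rewrite /S scalerA divff// scale1r.
have gaussS' x y z w : gauss_curvature x y (- S z) w = gauss_curvature x y z (- S w).
  by rewrite -!scaleNr gaussB.
clearbody S.
have Ap x : S x = x -> A x = (r + t / 2) *: x.
  by move=> Sx; rewrite AS Sx scalerDl.
have Am x : S x = - x -> A x = (- r + t / 2) *: x.
  by move=> Sx; rewrite AS Sx scalerDl scalerN scaleNr.
have lm : (r + t / 2) * (- r + t / 2) = - c.
  have -> : (r + t / 2) * (- r + t / 2) = t ^+ 2 / 4 - r * r by field.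
  by rewrite rr /d; ring.
(* The eigenspaces play symmetric roles: S' exchanges them. *)
pose S' z := - S z.
have S'D x y : S' (x + y) = S' x + S' y by rewrite /S' SD opprD.
have S'S' z : S' (S' z) = z by rewrite /S' SN opprK SS.
have S'sym x y : g (S' x) y = g x (S' y) by rewrite /S' !gE Ssym.
have hS' x y : h (S' x) y = h x (S' y).
  by rewrite /S' hN hS (hC x (- _)) hN hC.
have A'p x : S' x = x -> A x = (- r + t / 2) *: x.
  by move=> S'x; apply: Am; rewrite -[LHS]opprK -/(S' x) S'x.
have A'm x : S' x = - x -> A x = (r + t / 2) *: x.
  by move=> /oppr_inj; exact: Ap.
(* e = 1 or -1 according to the eigenspace of S that F kills. *)
have conclude (e : R) : e ^+ 2 = 1 -> (forall z, F (z + e *: S z) = 0) ->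
    exists lam mu : R, [/\ A U = lam *: U, forall z, g z U = 0 -> A z = mu *: z
      & lam = mu \/ lam * mu = - c].
  move=> e2 Fe; pose k := g (U + e *: S U) U.
  have Uk : U + e *: S U = k *: U by rewrite -kernel_structure_vector.
  have zk z : z + e *: S z = (k * g z U) *: U.
    rewrite [LHS]kernel_structure_vector//; congr (_ *: _).
    by rewrite !gE Ssym -[e * _](ipZr gP) -gE Uk gE.
  have Sz z : S z = e *: ((k * g z U) *: U - z).
    by rewrite -zk addrC addKr scalerA -expr2 e2 scale1r.
  have k2 : k * (k - 2) = 0.
    have := congr1 (g U) (SS U); rewrite {1}Sz.
    rewrite !gE UU Sz !gE UU !mulr1.
    move=> h1; have : e ^+ 2 * (k * (k - 2)) = 0 by lra.
    by rewrite e2 mul1r.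
  exists (r * (e * (k - 1)) + t / 2), (- (r * e) + t / 2).
  split=> [|z zU|].
  - rewrite AS Sz UU mulr1; apply: (ip_inj gP) => w; rewrite !gE; ring.
  - rewrite AS Sz zU mulr0 scale0r sub0r; apply: (ip_inj gP) => w; rewrite !gE; ring.
  - move/eqP: k2; rewrite mulf_eq0 subr_eq0 => /orP[]/eqP ->.
      by left; ring.
    right; rewrite -lm.
    have -> : (r * (e * (2 - 1)) + t / 2) * (- (r * e) + t / 2)
        = t ^+ 2 / 4 - e ^+ 2 * (r * r) by field.
    by rewrite e2; field.
have killp : (forall x, S x = x -> F x = 0) ->
    exists lam mu : R, [/\ A U = lam *: U, forall z, g z U = 0 -> A z = mu *: z
      & lam = mu \/ lam * mu = - c].
  move=> Fp; apply: (conclude 1) => [|z]; first by rewrite expr1n.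
  by rewrite scale1r; apply: Fp; rewrite SD SS addrC.
have killm : (forall x, S' x = x -> F x = 0) ->
    exists lam mu : R, [/\ A U = lam *: U, forall z, g z U = 0 -> A z = mu *: z
      & lam = mu \/ lam * mu = - c].
  move=> Fm; apply: (conclude (-1)) => [|z]; first by rewrite sqrrN expr1n.
  by rewrite scaleN1r; apply: Fm; rewrite S'D /S' SN opprK SS addrC.
have mix' : (forall x y, S' x = x -> S' y = - y -> g (F x) y = 0) ->
    forall x y, S x = x -> S y = - y -> g (F x) y = 0.
  move=> H x y Sx Sy; rewrite Fskew H ?oppr0 //; first by rewrite /S' Sy opprK.
  by rewrite /S' Sx.
have [Fmix|Fpp] := eigen_F_dichotomy SD Ssym hS gaussS Ap Am; last first.
  have [Fmix'|Fmm] := eigen_F_dichotomy S'D S'sym hS' gaussS' A'p A'm.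
    by apply: killp; apply: (plus_in_kernel SD SS) => //; exact: mix'.
  apply: killp; apply: (plus_in_kernel SD SS) => // x y Sx Sy.
  exact: (eigen_swap SD SS Ssym hS gaussS Ap Am lm).
have [Fpp|] := pselect (forall x z, S x = x -> S z = z -> g (F x) z = 0).
  by apply: killp; exact: (plus_in_kernel SD SS).
move=> /existsNP[x /existsNP[w /not_implyP[Sx /not_implyP[Sw /eqP xw]]]].
apply: killm; apply: (plus_in_kernel S'D S'S') => y z Sy Sz.
  rewrite Fskew Fmix ?oppr0//; first by rewrite -[LHS]opprK -/(S' z) Sz opprK.
  by rewrite -[LHS]opprK -/(S' y) Sy.
have Sy' : S y = - y by rewrite -[LHS]opprK -/(S' y) Sy.
have Sz' : S z = - z by rewrite -[LHS]opprK -/(S' z) Sz.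
have /eqP := eigen_block Ssym hS gaussS Ap Am lm Sx Sw Sy' Sz' Fmix.
by rewrite mulf_eq0 (negPf xw) orbF => /eqP.
Qed.

End CommutingShapeOperator.

(** * Differential calculus *)

Section Calculus.
Variable R : realType.
Implicit Types U V W : normedModType R.

Lemma differentiable_near_eq V W (f g : V -> W) x :
  (\near x, f x = g x) -> differentiable f x -> differentiable g x.
Proof.
move=> fg df; have dfc := diff_continuous df.
have gE : g \o shift x = cst (g x) + 'd f x +o_ 0 id.
  apply/eqaddoP => e e0; have /eqaddoP/(_ e e0) fe := diff_locally df.
  have fg0 : \forall h \near 0, f (h + x) = g (h + x).
    by rewrite (near_shift x) sub0r; near=> y; rewrite /= subrK; near: y.
  near=> h.
  have -> : (g \o shift x - (cst (g x) + 'd f x)) h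
      = (f \o shift x - (cst (f x) + 'd f x)) h.
    have fgh : f (h + x) = g (h + x) by near: h.
    rewrite -[LHS]/(g (h + x) - (g x + 'd f x h)) -fgh.
    by rewrite -(nbhs_singleton fg).
  by near: h.
by apply/diff_locallyP; rewrite (diff_unique dfc gE).
Unshelve. all: by end_near. Qed.

Lemma derive_comp U V W (f : V -> W) (p : U -> V) z v :
  differentiable p z -> differentiable f (p z) ->
  'D_v (f \o p) z = 'D_('D_v p z) f (p z).
Proof.
move=> dp df; rewrite !deriveE//; last exact: differentiable_comp.
by rewrite diff_comp.
Qed.

Lemma differentiable_line V (v p : V) t :
  differentiable (fun t : R => t *: v + p) t.
Proof.
by apply: differentiableD; [exact: differentiableZl|exact: differentiable_cst].
Qed.

Lemma derive_line V (v p : V) t : 'D_1 (fun t : R => t *: v + p) t = v.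
Proof.
rewrite deriveE; last exact: differentiable_line.
rewrite (_ : (fun _ => _) = ( *:%R^~ v) + cst p)// diffD//.
rewrite diff_cst diff_val [LHS]addr0 scale1r. by [].
Qed.

Lemma deriveDv V W (f : V -> W) x a v w : differentiable f x ->
  'D_(a *: v + w) f x = a *: 'D_v f x + 'D_w f x.
Proof. by move=> df; rewrite !deriveE// linearP. Qed.

(** The mean value theorem applied to t |-> f (x + t v + h w) - f (x + t v), followed
    by the first-order expansion of the derivative of f along v at x. *)
Lemma mixed_difference V (f : V -> R) x v w :
  (\near x, differentiable f x) -> differentiable ('D_v f) x ->
  forall e, 0 < e -> \forall h \near 0^'+,
    `|f (x + h *: v + h *: w) - f (x + h *: v) - f (x + h *: w) + f x
      - h ^+ 2 * 'D_w ('D_v f) x| <= e * h ^+ 2.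
Proof.
move=> df ddf e e0.
(* K h bounds the total length of the two increments compared below. *)
pose K := (`|v| + `|w|) + (`|v| + `|w|) + 1.
have K0 : 0 < K by rewrite ltr_wpDl// !addr_ge0.
have /eqaddoP/(_ (e / K)) := diff_locally ddf.
move=> /(_ (divr_gt0 e0 K0)) /nbhs_ballP[d1 /= d10 H1].
have := df => /nbhs_ballP[d2 /= d20 H2].
pose d := Num.min d1 d2 / K.
have d0 : 0 < d by rewrite divr_gt0// lt_min d10.
near=> h.
have h0 : 0 < h by near: h; exact: nbhs_right_gt.
have hd : h < d by near: h; exact: nbhs_right_lt.
have small t s : 0 <= t <= h -> 0 <= s <= h ->
    `|t *: v + s *: w| < Num.min d1 d2 /\ `|t *: v + s *: w| <= h * (`|v| + `|w|).
  move=> /andP[t0 th] /andP[s0 sh].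
  have B : `|t *: v + s *: w| <= h * (`|v| + `|w|).
    apply: (le_trans (ler_normD _ _)); rewrite !normrZ !ger0_norm// mulrDr.
    by apply: lerD; apply: ler_wpM2r.
  split=> //; apply: (le_lt_trans B).
  have : h * K < Num.min d1 d2 by rewrite -ltr_pdivlMr.
  apply: le_lt_trans; apply: ler_wpM2l; first exact: ltW.
  by rewrite /K; have := normr_ge0 v; have := normr_ge0 w; lra.
have dfx u : `|u| < Num.min d1 d2 -> differentiable f (x + u).
  move=> ud; apply: H2; rewrite -ball_normE /ball_ /= opprD addNKr normrN.
  by move: ud; rewrite lt_min => /andP[].
pose phi (t : R) := f (t *: v + (x + h *: w)) - f (t *: v + x).
have small0 t : 0 <= t <= h -> `|t *: v| < Num.min d1 d2 /\ `|t *: v| <= h * (`|v| + `|w|).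
  by move=> th; have := small t 0 th; rewrite lexx (ltW h0) scale0r addr0; apply.
have smallh t : 0 <= t <= h ->
    `|t *: v + h *: w| < Num.min d1 d2 /\ `|t *: v + h *: w| <= h * (`|v| + `|w|).
  by move=> th; have := small t h th; rewrite lexx (ltW h0); apply.
have fline p t : differentiable f (t *: v + p) ->
    is_derive t 1 (fun t : R => f (t *: v + p)) ('D_v f (t *: v + p)).
  move=> dfp; apply: DeriveDef.
    apply: diff_derivable; apply: (differentiable_comp (differentiable_line v p t)).
    exact: dfp.
  have := @derive_comp _ _ _ f (fun t : R => t *: v + p) t 1.
  by rewrite derive_line; apply => //; exact: differentiable_line.
have dphi (t : R) : 0 <= t <= h -> is_derive t 1 phi
    ('D_v f (t *: v + (x + h *: w)) - 'D_v f (t *: v + x)).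
  move=> th; apply: is_deriveB; apply: fline.
    by rewrite addrCA; apply: dfx; case: (smallh t th).
  by rewrite addrC; apply: dfx; case: (small0 t th).
have [c cab phiE] : exists2 c, c \in `]0, h[ & phi h - phi 0 =
    ('D_v f (c *: v + (x + h *: w)) - 'D_v f (c *: v + x)) * (h - 0).
  apply: (@MVT R phi (fun t => 'D_v f (t *: v + (x + h *: w)) - 'D_v f (t *: v + x))) => //.
    by move=> t; rewrite in_itv /= => /andP[t0 th]; apply: dphi; rewrite !ltW.
  apply: derivable_within_continuous => t; rewrite in_itv /= => th.
  by have [] := dphi t th.
have ch : 0 <= c <= h by move: cab; rewrite in_itv /= => /andP[c0 cc]; rewrite !ltW.
have [n1 b1] := smallh c ch; have [n2 b2] := small0 c ch.
have H1' u : `|u| < Num.min d1 d2 ->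
    `|'D_v f (u + x) - ('D_v f x + 'd ('D_v f) x u)| <= e / K * `|u|.
  move=> ud; apply: H1; rewrite -ball_normE /ball_ /= sub0r normrN.
  by move: ud; rewrite lt_min => /andP[].
have E1 := H1' _ n1; have E2 := H1' _ n2.
have -> : f (x + h *: v + h *: w) - f (x + h *: v) - f (x + h *: w) + f x
   = phi h - phi 0.
  rewrite /phi !scale0r !add0r addrCA addrA [h *: v + x]addrC.
  by rewrite opprB addrA addrAC.
rewrite phiE subr0 addrCA.
rewrite (addrC (c *: v) x) (addrC (c *: v + h *: w) x) in E1 E2 *.
have DE : 'D_w ('D_v f) x = 'd ('D_v f) x w by rewrite deriveE.
have dDE : 'd ('D_v f) x (c *: v + h *: w) = 'd ('D_v f) x (c *: v) + h * 'd ('D_v f) x w.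
  by rewrite linearD [in X in _ + X]linearZ.
rewrite {}DE; rewrite {}dDE in E1.
set D1 := 'D_v f (x + (_ + _)) in E1 *; set D2 := 'D_v f (x + c *: v) in E2 *.
set D0 := 'D_v f x in E1 E2; set L := 'd _ x w in E1 *.
set L' := 'd _ x _ in E1 E2.
rewrite (_ : _ - _ = (D1 - D2 - h * L) * h); last by ring.
rewrite normrM (gtr0_norm h0) expr2 mulrA ler_wpM2r// ?(ltW h0)//.
rewrite (_ : D1 - D2 - _ = (D1 - (D0 + (L' + h * L)))
   - (D2 - (D0 + L'))); last by ring.
apply: (le_trans (ler_normB _ _)); apply: (le_trans (lerD E1 E2)).
rewrite -mulrDr; apply: (@le_trans _ _ (e / K * (h * K))); last first.
  by rewrite (_ : e / K * (h * K) = e * h)//; field; rewrite gt_eqF.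
apply: ler_wpM2l; first by rewrite divr_ge0 ?ltW.
apply: (le_trans (lerD b1 b2)); rewrite -mulrDr ler_wpM2l ?ltW//.
by rewrite /K ltrDl.
Unshelve. all: by end_near. Qed.

(** The second difference of [mixed_difference] is symmetric in v and w. *)
Lemma mixed_derivativesC V (f : V -> R) x v w :
  (\near x, differentiable f x) -> differentiable ('D_v f) x ->
  differentiable ('D_w f) x -> 'D_w ('D_v f) x = 'D_v ('D_w f) x.
Proof.
move=> df dv dw; apply/eqP; rewrite -subr_eq0 -normr_le0.
apply/ler_addgt0Pr => e e0; rewrite add0r.
have e20 : 0 < e / 2 by rewrite divr_gt0.
have nvw := mixed_difference w df dv e20.
have nwv := mixed_difference v df dw e20.
have [h [h0 []]] := filter_ex (filterI (nbhs_right_gt (0 : R)) (filterI nwv nvw)).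
rewrite (addrAC x (h *: w)).
set a := f (x + _ + _); set b := f (x + h *: w); set b' := f (x + h *: v).
set X := 'D_v _ x; set Y := 'D_w _ x => H1 H2.
rewrite -(@ler_pM2r _ (h ^+ 2)) ?exprn_gt0//.
have h20 : 0 <= h ^+ 2 by rewrite exprn_ge0// ltW.
rewrite -{1}(ger0_norm h20) -normrM.
rewrite (_ : (Y - X) * h ^+ 2 = (a - b - b' + f x - h ^+ 2 * X)
   - (a - b' - b + f x - h ^+ 2 * Y)); last by ring.
apply: (le_trans (ler_normB _ _)); apply: (le_trans (lerD H1 H2)).
by rewrite -mulrDl -splitr. Qed.

End Calculus.

Section MatrixCalculus.
Variables (R : realType) (V : normedModType R).

Lemma differentiable_coords m n (M : V -> 'M[R]_(m, n)) x i j :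
  differentiable M x -> differentiable (fun y => M y i j : R) x.
Proof. by move=> dM; exact: (differentiable_comp dM (differentiable_coord _ i j)). Qed.

Lemma differentiable_mx m n (M : V -> 'M[R]_(m, n)) x :
  (forall i j, differentiable (fun y => M y i j : R) x) -> differentiable M x.
Proof.
move=> dM.
rewrite (_ : M = \sum_(i < m) \sum_(j < n) (fun y => M y i j *: delta_mx i j)).
  apply: differentiable_sum => i; apply: differentiable_sum => j.
  exact: differentiableZl.
apply/funext => y; rewrite {1}(matrix_sum_delta (M y)) fct_sumE.
by apply: eq_bigr => i _; rewrite fct_sumE.
Qed.

Lemma derive_mx_coord m n (M : V -> 'M[R]_(m, n)) x v i j :
  differentiable M x -> ('D_v M x) i j = 'D_v (fun y => M y i j : R) x.
Proof.
by move=> dM; rewrite derive_mx ?mxE//; exact: diff_derivable.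
Qed.

Lemma differentiable_bigsum (I : finType) (f : I -> V -> R) x :
  (forall i, differentiable (f i) x) ->
  differentiable (fun y => \sum_i f i y : R) x.
Proof.
move=> df; rewrite (_ : (fun _ => _) = \sum_(i < #|I|) f (enum_val i)).
  exact: differentiable_sum.
by apply/funext => y; rewrite fct_sumE (reindex _ (onW_bij _ (enum_val_bij I))).
Qed.

Lemma differentiable_bigprod (I : Type) (s : seq I) (f : I -> V -> R) x :
  (forall i, differentiable (f i) x) ->
  differentiable (fun y => \prod_(i <- s) f i y : R) x.
Proof.
move=> df; elim: s => [|i s IH].
  rewrite (_ : (fun _ => _) = cst 1); first exact: differentiable_cst.
  by apply/funext => y; rewrite big_nil.
rewrite (_ : (fun _ => _) = f i * (fun y => \prod_(j <- s) f j y)).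
  exact: differentiableM.
by apply/funext => y; rewrite big_cons.
Qed.

Lemma differentiable_mulmx m n p (A : V -> 'M[R]_(m, n)) (B : V -> 'M[R]_(n, p)) x :
  differentiable A x -> differentiable B x ->
  differentiable (fun y => A y *m B y) x.
Proof.
move=> dA dB; apply: differentiable_mx => i j.
rewrite (_ : (fun _ => _) = fun y => \sum_k A y i k * B y k j).
  by apply: differentiable_bigsum => k; apply: differentiableM;
     exact: differentiable_coords.
by apply/funext => y; rewrite mxE.
Qed.

Lemma derive_mulmx m n p (A : V -> 'M[R]_(m, n)) (B : V -> 'M[R]_(n, p)) x v :
  differentiable A x -> differentiable B x ->
  'D_v (fun y => A y *m B y) x = 'D_v A x *m B x + A x *m 'D_v B x.
Proof.
move=> dA dB; apply/matrixP => i j.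
rewrite derive_mx_coord; last exact: differentiable_mulmx.
have dAc k : derivable (fun y => A y i k : R) x v.
  by apply: diff_derivable; exact: differentiable_coords.
have dBc k : derivable (fun y => B y k j : R) x v.
  by apply: diff_derivable; exact: differentiable_coords.
rewrite (_ : (fun _ => _) = \sum_(k < n) ((fun y => A y i k) * (fun y => B y k j))).
  rewrite derive_sum; last by move=> k; exact: derivableM.
  rewrite !mxE -big_split /=; apply: eq_bigr => k _.
  rewrite deriveM//= (derive_mx_coord _ _ _ dA) (derive_mx_coord _ _ _ dB).
  by rewrite addrC; congr (_ + _); exact: mulrC.
by apply/funext => y; rewrite mxE fct_sumE.
Qed.

Lemma differentiable_trmx m n (A : V -> 'M[R]_(m, n)) x :
  differentiable A x -> differentiable (fun y => (A y)^T) x.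
Proof.
move=> dA; apply: differentiable_mx => i j.
rewrite (_ : (fun _ => _) = fun y => A y j i); first exact: differentiable_coords.
by apply/funext => y; rewrite mxE.
Qed.

Lemma derive_trmx m n (A : V -> 'M[R]_(m, n)) x v :
  differentiable A x -> 'D_v (fun y => (A y)^T) x = ('D_v A x)^T.
Proof.
move=> dA; apply/matrixP => i j.
rewrite derive_mx_coord ?mxE; last exact: differentiable_trmx.
rewrite derive_mx_coord//; congr ('D_v _ x).
by apply/funext => y; rewrite mxE.
Qed.

Lemma differentiable_det n (A : V -> 'M[R]_n) x :
  differentiable A x -> differentiable (fun y => \det (A y) : R) x.
Proof.
move=> dA; apply: (@differentiable_bigsum _
  (fun (s : 'S_n) y => (-1) ^+ s * \prod_i A y i (s i))) => s.
have -> : (fun y => (-1) ^+ s * \prod_i A y i (s i))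
    = (fun y => (-1) ^+ s *: \prod_i A y i (s i)) by [].
apply: differentiableZ.
by apply: differentiable_bigprod => i; exact: differentiable_coords.
Qed.

Lemma differentiable_invmx n (A : V -> 'M[R]_n) x :
  differentiable A x -> A x \in unitmx -> differentiable (fun y => invmx (A y)) x.
Proof.
move=> dA uA; have dd := differentiable_det dA.
have dx0 : \det (A x) != 0 by rewrite -unitfE.
apply: (@differentiable_near_eq _ _ _ (fun y => (\det (A y))^-1 *: \adj (A y))).
  have : \forall y \near x, \det (A y) != 0.
    exact: cvgr_neq0 (differentiable_continuous dd) dx0.
  by apply: filterS => y dy; rewrite /invmx unitmxE unitfE dy.
apply: differentiable_mx => i j.
rewrite (_ : (fun _ => _) = (fun y => (\det (A y))^-1) * (fun y => cofactor (A y) j i)).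
  apply: differentiableM; first exact: differentiableV.
  have -> : (fun y => cofactor (A y) j i)
      = (fun y => (-1) ^+ (j + i) *: \det (row' j (col' i (A y)))) by [].
  apply: differentiableZ.
  apply: differentiable_det; apply: differentiable_mx => k l.
  rewrite (_ : (fun _ => _) = fun y => A y (lift j k) (lift i l)).
    exact: differentiable_coords.
  by apply/funext => y; rewrite !mxE.
by apply/funext => y; rewrite !mxE.
Qed.

Lemma mixed_derivativesC_mx m n (f : V -> 'M[R]_(m, n)) x v w :
  (\near x, differentiable f x) -> differentiable ('D_v f) x ->
  differentiable ('D_w f) x -> 'D_w ('D_v f) x = 'D_v ('D_w f) x.
Proof.
move=> df dv dw; apply/matrixP => i j.
apply: etrans (derive_mx_coord w i j dv) _.
apply: etrans _ (esym (derive_mx_coord v i j dw)).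
have e u : \forall y \near x, ('D_u f y) i j = 'D_u (fun z => f z i j : R) y.
  by apply: filterS df => y dfy; rewrite derive_mx_coord.
apply: etrans (near_eq_derive _ (e v)) _.
apply: etrans _ (esym (near_eq_derive _ (e w))).
apply: mixed_derivativesC.
- by apply: filterS df => y; exact: differentiable_coords.
- exact: differentiable_near_eq (e v) (differentiable_coords i j dv).
- exact: differentiable_near_eq (e w) (differentiable_coords i j dw).
Qed.

End MatrixCalculus.

Section LinearFamilies.
Variables (R : realType) (V : normedModType R).

Lemma linear_family_mulmx p q (C : 'rV[R]_p -> 'rV[R]_q) :
  (forall k a b, C (k *: a + b) = k *: C a + C b) ->
  forall a, C a = a *m \matrix_i C (delta_mx 0 i).
Proof.
move=> Cl a; pose L : {linear 'rV[R]_p -> 'rV[R]_q} :=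
  HB.pack C (GRing.isLinear.Build _ _ _ _ C Cl).
rewrite mulmx_sum_row {1}(row_sum_delta a) -[C]/(L : _ -> _) linear_sum.
by apply: eq_bigr => i _; rewrite linearZ rowK.
Qed.

(** The product rule for the pairing of a family of linear maps with a vector field:
    linear maps between row vectors are multiplications by matrices. *)
Lemma linear_family_derive p q (C : V -> 'rV[R]_p -> 'rV[R]_q)
    (a : V -> 'rV[R]_p) z v :
  (\forall y \near z, forall k a b, C y (k *: a + b) = k *: C y a + C y b) ->
  (forall b, differentiable (C ^~ b) z) -> differentiable a z ->
  differentiable (fun y => C y (a y)) z /\
  'D_v (fun y => C y (a y)) z = 'D_v (C ^~ (a z)) z + C z ('D_v a z).
Proof.
move=> Cl dC da; pose CM y := \matrix_i C y (delta_mx 0 i).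
have CE : \forall y \near z, forall b, b *m CM y = C y b.
  by apply: filterS Cl => y Cy b; rewrite (linear_family_mulmx Cy b).
have dCM : differentiable CM z.
  apply: differentiable_mx => i j.
  rewrite (_ : (fun _ => _) = fun y => C y (delta_mx 0 i) 0 j).
    exact: differentiable_coords.
  by apply/funext => y; rewrite mxE.
have e1 : \forall y \near z, a y *m CM y = C y (a y) by apply: filterS CE.
have e2 : \forall y \near z, a z *m CM y = C y (a z) by apply: filterS CE.
split; first by apply: differentiable_near_eq e1 _; exact: differentiable_mulmx.
rewrite -(near_eq_derive _ e1) -(near_eq_derive _ e2) !derive_mulmx//.
  by rewrite derive_cst mul0mx add0r addrC (nbhs_singleton CE).
Qed.

Lemma bilinear_family_derive p q r (B : V -> 'rV[R]_p -> 'rV[R]_q -> 'rV[R]_r)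
    (a : V -> 'rV[R]_p) (b : V -> 'rV[R]_q) z v :
  (\forall y \near z, forall k x x' t,
    B y (k *: x + x') t = k *: B y x t + B y x' t) ->
  (\forall y \near z, forall k x t t',
    B y x (k *: t + t') = k *: B y x t + B y x t') ->
  (forall x t, differentiable (fun y => B y x t) z) ->
  differentiable a z -> differentiable b z ->
  differentiable (fun y => B y (a y) (b y)) z /\
  'D_v (fun y => B y (a y) (b y)) z = 'D_v (fun y => B y (a z) (b z)) z
    + B z ('D_v a z) (b z) + B z (a z) ('D_v b z).
Proof.
move=> Bl Br dB da db.
have Bt t : differentiable (fun y => B y (a y) t) z /\
  'D_v (fun y => B y (a y) t) z = 'D_v (fun y => B y (a z) t) z + B z ('D_v a z) t.
  apply: (linear_family_derive (C := fun y x => B y x t)) => //.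
  by apply: filterS Bl.
have [||//|d1 d2] := @linear_family_derive _ _ (fun y => B y (a y)) b z v.
- by apply: filterS Br.
- by move=> t; have [] := Bt t.
by split=> //; rewrite d2; have [_ ->] := Bt (b z).
Qed.

Lemma differentiable_inner n (G : V -> 'M[R]_n) (s t : V -> 'rV[R]_n) z :
  differentiable G z -> differentiable s z -> differentiable t z ->
  differentiable (fun y => inner (G y) (s y) (t y) : R) z.
Proof.
move=> dG ds dt; apply: differentiable_coords.
exact: differentiable_mulmx (differentiable_mulmx ds dG) (differentiable_trmx dt).
Qed.

Lemma derive_inner n (G : V -> 'M[R]_n) (s t : V -> 'rV[R]_n) z v :
  differentiable G z -> differentiable s z -> differentiable t z ->
  'D_v (fun y => inner (G y) (s y) (t y) : R) z = inner ('D_v G z) (s z) (t z)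
    + inner (G z) ('D_v s z) (t z) + inner (G z) (s z) ('D_v t z).
Proof.
move=> dG ds dt; have dsG := differentiable_mulmx ds dG.
have dtT := differentiable_trmx dt.
rewrite /inner -derive_mx_coord; last exact: differentiable_mulmx.
rewrite derive_mulmx// derive_mulmx// derive_trmx// mulmxDl.
have mxD (a b : 'M[R]_1) : (a + b) 0 0 = a 0 0 + b 0 0 by rewrite mxE.
by rewrite !mxD; congr (_ + _); exact: addrC.
Qed.

End LinearFamilies.

Section Smooth.
Variables (R : realType) (V W : normedModType R) (U : set V).
Implicit Type f : V -> W.

Lemma smooth_differentiable f x : smooth U f -> U x -> differentiable f x.
Proof. by move=> /(_ 1%N)[+ _]; apply. Qed.

Lemma smooth_derive f v : smooth U f -> smooth U ('D_v f).
Proof. by move=> sf k; have [_] := sf k.+1; exact. Qed.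

Lemma smooth_cst (w : W) : smooth U (cst w).
Proof.
move=> k; elim: k w => [|k IH] w /=; first by move=> x _; exact: cst_continuous.
split=> [x _|v]; first exact: differentiable_cst.
rewrite (_ : (fun _ => _) = cst 0)//.
by apply/funext => x; exact: derive_cst.
Qed.

Lemma open_near (P : V -> Prop) x : open U -> U x -> (forall z, U z -> P z) ->
  \forall z \near x, P z.
Proof. by move=> Uo Ux UP; apply: filterS (open_nbhs_nbhs (conj Uo Ux)). Qed.

Definition twice_differentiable f : Prop :=
  (forall x, U x -> differentiable f x) /\
  forall v x, U x -> differentiable ('D_v f) x.

Lemma smooth_twice f : smooth U f -> twice_differentiable f.
Proof.
move=> sf; split=> [x|v x]; first exact: smooth_differentiable.
by move=> Ux; apply: smooth_differentiable Ux; exact: smooth_derive.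
Qed.

End Smooth.

(** * Levi-Civita connections *)

Section InnerForm.
Variables (R : realType) (n : nat).

Lemma inner_bilinear (G : 'M[R]_n) a u v w :
  inner G (a *: u + v) w = a * inner G u w + inner G v w.
Proof. by rewrite /inner -!mulmxA mulmxDl -scalemxAl !mxE. Qed.

Lemma inner_sym (G : 'M[R]_n) u v : G^T = G -> inner G u v = inner G v u.
Proof.
move=> Gt; have e : v *m G *m u^T = (u *m G *m v^T)^T.
  by rewrite !trmx_mul trmxK Gt mulmxA.
by rewrite /inner e [RHS]mxE.
Qed.

Lemma innerP (G : 'M[R]_n) : G^T = G ->
  (forall v, v != 0 -> 0 < inner G v v) -> inner_product (inner G).
Proof.
by move=> Gt Gp; split=> [x y|a x y z|]//; [exact: inner_sym|exact: inner_bilinear].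
Qed.

Lemma inner_unitmx (G : 'M[R]_n) : inner_product (inner G) -> G \in unitmx.
Proof.
move=> GP; rewrite -row_free_unit -kermx_eq0; apply/eqP/row_matrixP => i.
rewrite row0; apply: (ip_eq0 GP).
by rewrite /inner -row_mul mulmx_ker row0 mul0mx mxE.
Qed.

Lemma inner_linear_r (G : 'M[R]_n) a u v w :
  inner G w (a *: u + v) = a * inner G w u + inner G w v.
Proof. by rewrite /inner linearP /= mulmxDr -scalemxAr !mxE. Qed.

Lemma inner_linear_form a (G H : 'M[R]_n) u v :
  inner (a *: G + H) u v = a * inner G u v + inner H u v.
Proof. by rewrite /inner mulmxDr mulmxDl -scalemxAr -scalemxAl !mxE. Qed.

Lemma linear_form_sum (L : 'rV[R]_n -> R) w :
  (forall a x y, L (a *: x + y) = a * L x + L y) ->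
  L w = \sum_k w 0 k * L (delta_mx 0 k).
Proof.
move=> Ll; have L0 : L 0 = 0.
  by have := Ll (-1) 0 0; rewrite scaler0 addr0 mulN1r addNr.
rewrite {1}(row_sum_delta w) (big_morph L (id1 := 0) (op1 := +%R))//.
  by apply: eq_bigr => k _; rewrite -[_ *: _]addr0 Ll L0 addr0.
by move=> x y; rewrite -[x]scale1r Ll mul1r scale1r.
Qed.

(** Raising the index of a linear form. *)
Lemma inner_row_invmx (G : 'M[R]_n) (L : 'rV[R]_n -> R) w : G \in unitmx ->
  (forall a x y, L (a *: x + y) = a * L x + L y) ->
  inner G ((\row_k L (delta_mx 0 k)) *m invmx G) w = L w.
Proof.
move=> Gu Ll; rewrite /inner mulmxKV// (linear_form_sum w Ll) mxE.
by apply: eq_bigr => k _; rewrite !mxE mulrC.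
Qed.

End InnerForm.


Section MetricJet.
Variables (R : realType) (n : nat) (G : 'M[R]_n) (dG : 'rV[R]_n -> 'M[R]_n).
Hypotheses (GP : inner_product (inner G)).
Hypothesis dG_linear : forall a w w', dG (a *: w + w') = a *: dG w + dG w'.
Hypothesis dG_sym : forall w, (dG w)^T = dG w.

Let form u v w :=
  2^-1 * (inner (dG u) v w + inner (dG v) u w - inner (dG w) u v).
Let Gamma u v := (\row_k form u v (delta_mx 0 k)) *m invmx G.

Let dG_formC u v w : inner (dG u) v w = inner (dG u) w v.
Proof. exact: inner_sym. Qed.

Lemma jet_koszul u v w : inner G (Gamma u v) w = form u v w.
Proof.
apply: inner_row_invmx; first exact: inner_unitmx.
move=> a x y; rewrite /form dG_linear inner_linear_form !inner_linear_r; ring.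
Qed.

Lemma jet_compat u v w :
  inner (dG u) v w = inner G (Gamma u v) w + inner G v (Gamma u w).
Proof.
rewrite (ipC GP v) !jet_koszul /form (dG_formC u w v) (dG_formC v u w).
by rewrite (dG_formC w u v); field.
Qed.

Lemma jet_christoffelC u v : Gamma u v = Gamma v u.
Proof.
apply: (ip_inj GP) => w; rewrite !jet_koszul /form (dG_formC w u v); ring.
Qed.

Lemma jet_christoffel_linear a u u' v :
  Gamma (a *: u + u') v = a *: Gamma u v + Gamma u' v.
Proof.
apply: (ip_inj GP) => w; rewrite inner_bilinear !jet_koszul /form.
by rewrite dG_linear !inner_linear_form !inner_bilinear; ring.
Qed.

End MetricJet.

Definition local_metric (R : realType) (n : nat) (D : set 'rV[R]_n)
    (G : 'rV[R]_n -> 'M[R]_n) : Prop :=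
  [/\ open D, smooth D G, forall y, D y -> (G y)^T = G y
    & forall y v, D y -> v != 0 -> 0 < inner (G y) v v].

Section Connection.
Variables (R : realType) (n : nat) (D : set 'rV[R]_n) (G : 'rV[R]_n -> 'M[R]_n).
Hypothesis GM : local_metric D G.

Lemma local_metric_open : open D.
Proof. by case: GM. Qed.

Lemma metricP y : D y -> inner_product (inner (G y)).
Proof.
case: GM => _ _ Gsym Gpos Dy.
by apply: innerP; [exact: Gsym|move=> v; exact: Gpos].
Qed.

Lemma metric_smooth : smooth D G.
Proof. by case: GM. Qed.

Lemma metric_differentiable y : D y -> differentiable G y.
Proof. exact: smooth_differentiable metric_smooth. Qed.

Lemma derive_metric_linear y a w w' : D y ->
  'D_(a *: w + w') G y = a *: 'D_w G y + 'D_w' G y.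
Proof. by move=> Dy; apply: deriveDv; exact: metric_differentiable. Qed.

Lemma derive_metric_sym u y : D y -> ('D_u G y)^T = 'D_u G y.
Proof.
move=> Dy; apply: etrans (esym (derive_trmx u (metric_differentiable Dy))) _.
apply: near_eq_derive; apply: (open_near local_metric_open Dy).
by case: GM.
Qed.

Lemma koszul u v w y : D y ->
  inner (G y) (christoffel G y u v) w
    = 2^-1 * (inner ('D_u G y) v w + inner ('D_v G y) u w - inner ('D_w G y) u v).
Proof.
move=> Dy; apply: (@jet_koszul _ _ _ (fun w => 'D_w G y)).
- exact: metricP.
- by move=> a x x'; exact: derive_metric_linear.
Qed.

Lemma christoffel_compat u v w y : D y ->
  inner ('D_u G y) v w
  = inner (G y) (christoffel G y u v) w + inner (G y) v (christoffel G y u w).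
Proof.
move=> Dy; apply: (@jet_compat _ _ _ (fun w => 'D_w G y)).
- exact: metricP.
- by move=> a x x'; exact: derive_metric_linear.
- by move=> x; exact: derive_metric_sym.
Qed.

Lemma christoffelC u v y : D y -> christoffel G y u v = christoffel G y v u.
Proof.
move=> Dy; apply: (@jet_christoffelC _ _ _ (fun w => 'D_w G y)).
- exact: metricP.
- by move=> a x x'; exact: derive_metric_linear.
- by move=> x; exact: derive_metric_sym.
Qed.

Lemma christoffel_linear_l a u u' v y : D y ->
  christoffel G y (a *: u + u') v
    = a *: christoffel G y u v + christoffel G y u' v.
Proof.
move=> Dy; apply: (@jet_christoffel_linear _ _ _ (fun w => 'D_w G y)).
- exact: metricP.
- by move=> b x x'; exact: derive_metric_linear.
Qed.

Lemma christoffel_linear_r a u v v' y : D y ->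
  christoffel G y u (a *: v + v')
    = a *: christoffel G y u v + christoffel G y u v'.
Proof.
move=> Dy; rewrite (christoffelC u (a *: v + v') Dy) (christoffelC u v Dy).
by rewrite (christoffelC u v' Dy); exact: christoffel_linear_l.
Qed.

Lemma christoffel_differentiable u v y : D y ->
  differentiable (fun z => christoffel G z u v) y.
Proof.
move=> Dy; apply: differentiable_mulmx; last first.
  apply: differentiable_invmx; first exact: metric_differentiable.
  exact: inner_unitmx (metricP Dy).
apply: differentiable_mx => i k.
have dDG w : differentiable ('D_w G) y.
  by apply: smooth_differentiable Dy; apply: smooth_derive; exact: metric_smooth.
have dI w a b : differentiable (fun z => inner ('D_w G z) a b : R) y.
  apply: (@differentiable_inner _ _ _ ('D_w G) (cst a) (cst b)).
  - exact: dDG.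
  - exact: differentiable_cst.
  - exact: differentiable_cst.
rewrite (_ : (fun _ => _) = fun z => 2^-1 *: (inner ('D_u G z) v (delta_mx 0 k)
    + inner ('D_v G z) u (delta_mx 0 k) - inner ('D_(delta_mx 0 k) G z) u v)).
  by apply: differentiableZ; apply: differentiableB => //; apply: differentiableD.
by apply/funext => z; rewrite mxE.
Qed.

Lemma christoffel_cst u v y : levi_civita G (cst u) (cst v) y = christoffel G y u v.
Proof. by rewrite /levi_civita derive_cst add0r. Qed.

Lemma riemannE u v w y : D y -> riemann G y u v w =
  'D_u (fun z => christoffel G z v w) y - 'D_v (fun z => christoffel G z u w) y
  + (christoffel G y u (christoffel G y v w) - christoffel G y v (christoffel G y u w)).
Proof.
move=> Dy; rewrite /riemann /curvature.
have ccst a b : levi_civita G (cst a) (cst b) = fun z => christoffel G z a b.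
  by apply/funext => z; exact: christoffel_cst.
rewrite !ccst [levi_civita G (lie_bracket _ _) _ y]/levi_civita derive_cst.
have -> : lie_bracket (cst u) (cst v) y = 0.
  by rewrite /lie_bracket !derive_cst subrr.
have c0 : christoffel G y 0 w = 0.
  by have := christoffel_linear_l (-1) 0 0 w Dy; rewrite scaler0 addr0 scaleN1r addNr.
have swap (a b a' b' : 'rV[R]_n) : a + b - (a' + b') = a - a' + (b - b').
  by rewrite opprD addrACA.
by rewrite c0 addr0 subr0; exact: swap.
Qed.

End Connection.

(** * Covariant derivatives along a map *)

Section CovariantDerivative.
Variables (R : realType) (m n : nat) (D : set 'rV[R]_n) (G : 'rV[R]_n -> 'M[R]_n).
Hypothesis GM : local_metric D G.
Variables (U : set 'rV[R]_m) (phi : 'rV[R]_m -> 'rV[R]_n).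
Hypotheses (Uo : open U) (phiU : forall z, U z -> D (phi z)).
Hypothesis phi2 : twice_differentiable U phi.
Implicit Types (s t : 'rV[R]_m -> 'rV[R]_n) (v w z : 'rV[R]_m).

(** The covariant derivative along phi of a vector field s of the target, in the
    direction v.  For phi the identity this is the Levi-Civita connection, and the
    second fundamental form of phi is the normal part of cov ('D_w phi) v. *)
Definition cov s v z : 'rV[R]_n :=
  'D_v s z + christoffel G (phi z) ('D_v phi z) (s z).

Let Gamma z := christoffel G (phi z).

Lemma derive_metric_along v z : U z ->
  'D_v (fun y => G (phi y)) z = 'D_('D_v phi z) G (phi z).
Proof.
move=> Uz; apply: (@derive_comp _ _ _ _ G phi).
  exact: phi2.1.
exact: (metric_differentiable GM (phiU Uz)).
Qed.

Lemma metric_along_differentiable z : U z -> differentiable (fun y => G (phi y)) z.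
Proof.
move=> Uz; apply: (@differentiable_comp _ _ _ _ phi G); first exact: phi2.1.
exact: (metric_differentiable GM (phiU Uz)).
Qed.

Lemma cov_compat s t v z : U z -> differentiable s z -> differentiable t z ->
  'D_v (fun y => inner (G (phi y)) (s y) (t y) : R) z
    = inner (G (phi z)) (cov s v z) (t z) + inner (G (phi z)) (s z) (cov t v z).
Proof.
move=> Uz ds dt; have Dz := phiU Uz.
apply: etrans (derive_inner v (metric_along_differentiable Uz) ds dt) _.
rewrite derive_metric_along//.
rewrite (christoffel_compat GM _ _ _ Dz) /cov.
rewrite (ipDl (metricP GM Dz)) (ipDr (metricP GM Dz)).
set a := inner _ _ _; set b := inner _ _ _; set c := inner _ _ _.
set d := inner _ _ _; ring.
Qed.

Lemma cov_linear s a v w z : U z -> differentiable s z ->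
  cov s (a *: v + w) z = a *: cov s v z + cov s w z.
Proof.
move=> Uz ds; have Dz := phiU Uz; rewrite /cov.
rewrite (deriveDv _ _ _ ds) (deriveDv _ _ _ (phi2.1 _ Uz)).
rewrite (christoffel_linear_l GM _ _ _ _ Dz).
have alg (x x' y y' : 'rV[R]_n) : a *: x + x' + (a *: y + y') = a *: (x + y) + (x' + y').
  by rewrite scalerDr addrACA.
exact: alg.
Qed.

(** Symmetry of second derivatives and of the Christoffel symbols. *)
Lemma cov_torsion v w z : U z -> cov ('D_w phi) v z = cov ('D_v phi) w z.
Proof.
move=> Uz; have Dz := phiU Uz; rewrite /cov.
have e := mixed_derivativesC_mx (open_near Uo Uz phi2.1) (phi2.2 w z Uz) (phi2.2 v z Uz).
exact: (congr2 (fun a b : 'rV[R]_n => a + b) e (christoffelC GM _ _ Dz)).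
Qed.

Lemma christoffel_along_derive (a b : 'rV[R]_m -> 'rV[R]_n) v z : U z ->
  differentiable a z -> differentiable b z ->
  differentiable (fun y => Gamma y (a y) (b y)) z /\
  'D_v (fun y => Gamma y (a y) (b y)) z
    = 'D_('D_v phi z) (fun x => christoffel G x (a z) (b z)) (phi z)
      + Gamma z ('D_v a z) (b z) + Gamma z (a z) ('D_v b z).
Proof.
move=> Uz da db; have Dz := phiU Uz.
have dG (x x' : 'rV[R]_n) : differentiable (fun y => christoffel G y x x') (phi z).
  exact: (christoffel_differentiable GM _ _ Dz).
have [|||//|//|d1 d2] := @bilinear_family_derive _ _ _ _ _ Gamma a b z v.
- apply: (open_near Uo Uz) => y Uy k x x' x''.
  exact: (christoffel_linear_l GM _ _ _ _ (phiU Uy)).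
- apply: (open_near Uo Uz) => y Uy k x x' x''.
  exact: (christoffel_linear_r GM _ _ _ _ (phiU Uy)).
- by move=> x x'; exact: (differentiable_comp (phi2.1 _ Uz) (dG x x')).
split; first exact: d1.
apply: etrans d2 _; exact: (congr1 (fun c : 'rV[R]_n =>
  c + Gamma z ('D_v a z) (b z) + Gamma z (a z) ('D_v b z))
  (derive_comp v (phi2.1 _ Uz) (dG _ _))).
Qed.

Lemma cov_differentiable s v z : twice_differentiable U s -> U z ->
  differentiable (cov s v) z.
Proof.
move=> s2 Uz; apply: differentiableD; first exact: s2.2.
by have [] := christoffel_along_derive v Uz (phi2.2 v z Uz) (s2.1 z Uz).
Qed.

Lemma cov_cov s v w z : twice_differentiable U s -> U z ->
  cov (cov s w) v z = 'D_v ('D_w s) z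
    + 'D_('D_v phi z) (fun x => christoffel G x ('D_w phi z) (s z)) (phi z)
    + Gamma z ('D_v ('D_w phi) z) (s z) + Gamma z ('D_w phi z) ('D_v s z)
    + (Gamma z ('D_v phi z) ('D_w s z)
    + Gamma z ('D_v phi z) (Gamma z ('D_w phi z) (s z))).
Proof.
move=> s2 Uz; have Dz := phiU Uz.
have [dg eg] := christoffel_along_derive v Uz (phi2.2 w z Uz) (s2.1 z Uz).
have lin (x y y' : 'rV[R]_n) : Gamma z x (y + y') = Gamma z x y + Gamma z x y'.
  by have := christoffel_linear_r GM 1 x y y' Dz; rewrite !scale1r.
have e1 : 'D_v (cov s w) z
    = 'D_v ('D_w s) z + 'D_v (fun y => Gamma y ('D_w phi y) (s y)) z.
  exact: (deriveD (diff_derivable (s2.2 w z Uz)) (diff_derivable dg)).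
apply: etrans (congr2 (fun a b : 'rV[R]_n => a + b) e1 (lin _ _ _)) _.
have alg (a b c e f : 'rV[R]_n) : b = c -> a + b + (e + f) = a + c + (e + f).
  by move=> ->.
apply: etrans (alg _ _ _ _ _ eg) _.
have alg' (a b c d e : 'rV[R]_n) : a + (b + c + d) + e = a + b + c + d + e.
  by rewrite !addrA.
exact: alg'.
Qed.

(** Expanding both sides, the terms that are not in the curvature are symmetric in
    v and w, by symmetry of the second derivatives of s and phi. *)
Lemma cov_curvature s v w z : twice_differentiable U s -> U z ->
  cov (cov s w) v z - cov (cov s v) w z
    = riemann G (phi z) ('D_v phi z) ('D_w phi z) (s z).
Proof.
move=> s2 Uz; have Dz := phiU Uz.
apply: etrans _ (esym (riemannE GM _ _ _ Dz)).
have ephi := mixed_derivativesC_mx (open_near Uo Uz phi2.1) (phi2.2 w z Uz) (phi2.2 v z Uz).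
have es := mixed_derivativesC_mx (open_near Uo Uz s2.1) (s2.2 w z Uz) (s2.2 v z Uz).
apply: etrans (congr2 (fun a b : 'rV[R]_n => a - b)
  (cov_cov v w s2 Uz) (cov_cov w v s2 Uz)) _.
have alg (a b b' c d d' e e' : 'rV[R]_n) :
    a + b + c + d + (d' + e) - (a + b' + c + d' + (d + e')) = b - b' + (e - e').
  apply/eqP; rewrite -subr_eq0; apply/eqP/matrixP => i j; rewrite !mxE; ring.
apply: etrans (alg _ _ _ _ _ _ _ _).
exact: (congr2 (fun x y : 'rV[R]_n => _ + _ + _ + _ + (_ + _)
  - (x + _ + Gamma z y (s z) + _ + (_ + _))) (esym es) (esym ephi)).
Qed.

Lemma cov_add s t v z : U z -> differentiable s z -> differentiable t z ->
  cov (fun y => s y + t y) v z = cov s v z + cov t v z.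
Proof.
move=> Uz ds dt; have Dz := phiU Uz; rewrite /cov.
have e := christoffel_linear_r GM 1 ('D_v phi z) (s z) (t z) Dz.
rewrite !scale1r in e.
have alg (x y y' g g' : 'rV[R]_n) : x = y + y' -> x + (g + g') = y + g + (y' + g').
  by move=> ->; rewrite addrACA.
rewrite e; apply: alg.
exact: (deriveD (diff_derivable ds) (diff_derivable dt)).
Qed.

Lemma cov_scale (k : 'rV[R]_m -> R) s v z : U z ->
  differentiable k z -> differentiable s z ->
  differentiable (fun y => k y *: s y) z /\
  cov (fun y => k y *: s y) v z = 'D_v k z *: s z + k z *: cov s v z.
Proof.
move=> Uz dk ds; have Dz := phiU Uz.
have dks : differentiable (fun y => k y *: s y) z.
  apply: differentiable_mx => i j.
  rewrite (_ : (fun _ => _) = k * (fun y => s y i j)).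
    by apply: differentiableM => //; exact: differentiable_coords.
  by apply/funext => y; rewrite mxE.
split; first exact: dks.
have e := christoffel_linear_r GM (k z) ('D_v phi z) (s z) 0 Dz.
have e0 := christoffel_linear_r GM (-1) ('D_v phi z) 0 0 Dz.
have Gamma0 : christoffel G (phi z) ('D_v phi z) 0 = 0.
  by move: e0; rewrite scaler0 addr0 scaleN1r addNr.
have alg (x y g g' : 'rV[R]_n) : x = 'D_v k z *: s z + k z *: y ->
    g' = k z *: g -> x + g' = 'D_v k z *: s z + k z *: (y + g).
  by move=> -> ->; rewrite scalerDr addrA.
apply: alg; last by move: e; rewrite addr0 => ->; rewrite Gamma0 addr0.
apply/matrixP => i j; apply: etrans (derive_mx_coord v i j dks) _.
have dsij := differentiable_coords i j ds.
rewrite (_ : (fun _ => _) = k * (fun y => s y i j)); last first.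
  by apply/funext => y; rewrite mxE.
apply: etrans (deriveM (diff_derivable dk) (diff_derivable dsij)) _.
rewrite mxE [X in _ = X + _]mxE [X in _ = _ + X]mxE (derive_mx_coord v i j ds).
by rewrite addrC; congr (_ + _); exact: mulrC.
Qed.

(** Only the first term involves the derivative of X, and it is tangent: the normal part
    of the covariant derivative is tensorial in X. *)
Lemma cov_pushforward (X : 'rV[R]_m -> 'rV[R]_m) v z : U z ->
  differentiable X z ->
  differentiable (fun y => 'D_(X y) phi y) z /\
  cov (fun y => 'D_(X y) phi y) v z
    = 'D_('D_v X z) phi z + cov ('D_(X z) phi) v z.
Proof.
move=> Uz dX.
have [||//|d1 d2] := @linear_family_derive _ _ _ _ (fun y x => 'D_x phi y) X z v.
- by apply: (open_near Uo Uz) => y Uy k a b; exact: deriveDv (phi2.1 _ Uy).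
- by move=> b; exact: phi2.2.
split; first exact: d1.
have alg (x y y' g : 'rV[R]_n) : x = y' + y -> x + g = y + (y' + g).
  by move=> ->; rewrite addrA (addrC y).
exact: (alg _ _ _ _ d2).
Qed.

End CovariantDerivative.

(** * Kaehler manifolds of constant holomorphic curvature *)

Section AmbientCurvature.
Variables (R : realType) (n : nat) (D : set 'rV[R]_n) (G : 'rV[R]_n -> 'M[R]_n).
Hypothesis GM : local_metric D G.
Implicit Types (u v w x y : 'rV[R]_n).

Let Do : open D. Proof. exact: local_metric_open GM. Qed.

Lemma derive_idE v y : 'D_v (fun x : 'rV[R]_n => x) y = v.
Proof. exact: derive_id. Qed.

Lemma twice_differentiable_id : twice_differentiable D (fun x : 'rV[R]_n => x).
Proof.
split=> [x _|v x _]; first exact: ex_diff.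
rewrite (_ : 'D_v _ = cst v); first exact: differentiable_cst.
by apply/funext => z; exact: derive_idE.
Qed.

Lemma twice_differentiable_cst w : twice_differentiable D (cst w : 'rV[R]_n -> 'rV[R]_n).
Proof. exact: smooth_twice (@smooth_cst _ _ _ _ _). Qed.

Let cv s v y := cov G (fun x : 'rV[R]_n => x) s v y.

Lemma riemann_cov s u v y : twice_differentiable D s -> D y ->
  riemann G y u v (s y) = cv (cv s v) u y - cv (cv s u) v y.
Proof.
move=> s2 Dy.
have := @cov_curvature _ _ _ _ _ GM D (fun x => x) Do (fun _ h => h)
  twice_differentiable_id s u v y s2 Dy.
by rewrite !derive_idE => <-.
Qed.

Lemma riemann_skew12 u v w y : D y -> riemann G y v u w = - riemann G y u v w.
Proof.
move=> Dy; apply: etrans (riemannE GM _ _ _ Dy) _.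
apply: etrans _ (congr1 -%R (esym (riemannE GM _ _ _ Dy))).
have alg (a b a' b' : 'rV[R]_n) : a - b + (a' - b') = - (b - a + (b' - a')).
  by rewrite opprD !opprB.
exact: alg.
Qed.

Lemma derive_christoffelC u v w y : D y ->
  'D_u (fun z => christoffel G z v w) y = 'D_u (fun z => christoffel G z w v) y.
Proof.
move=> Dy; apply: near_eq_derive; apply: (open_near Do Dy) => z Dz.
exact: (christoffelC GM _ _ Dz).
Qed.

Lemma riemann_bianchi u v w y : D y ->
  riemann G y u v w + riemann G y v w u + riemann G y w u v = 0.
Proof.
move=> Dy; apply: etrans (congr2 (fun a b : 'rV[R]_n => a + b)
  (congr2 (fun a b : 'rV[R]_n => a + b) (riemannE GM _ _ _ Dy)
    (riemannE GM _ _ _ Dy)) (riemannE GM _ _ _ Dy)) _.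
have alg (a a' b b' c c' d d' e e' f f' : 'rV[R]_n) : a = a' -> b = b' -> c = c' ->
    d = d' -> e = e' -> f = f' ->
    a - b + (d - e) + (b' - c + (e' - f)) + (c' - a' + (f' - d')) = 0.
  move=> -> -> -> -> -> ->.
  by apply/matrixP => i j; rewrite !mxE; ring.
apply: alg.
- exact: (derive_christoffelC u v w Dy).
- exact: (derive_christoffelC v u w Dy).
- exact: (derive_christoffelC w v u Dy).
- by rewrite (christoffelC GM v w Dy).
- by rewrite (christoffelC GM u w Dy).
- by rewrite (christoffelC GM v u Dy).
Qed.

Lemma riemannDl u u' v w y : D y ->
  riemann G y (u + u') v w = riemann G y u v w + riemann G y u' v w.
Proof.
move=> Dy; apply: etrans (riemannE GM _ _ _ Dy) _.
apply: etrans _ (congr2 (fun a b : 'rV[R]_n => a + b)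
  (esym (riemannE GM _ _ _ Dy)) (esym (riemannE GM _ _ _ Dy))).
have Gl z x : D z ->
    christoffel G z (u + u') x = christoffel G z u x + christoffel G z u' x.
  by move=> Dz; have := christoffel_linear_l GM 1 u u' x Dz; rewrite !scale1r.
have Gr x x' z : D z ->
    christoffel G z v (x + x') = christoffel G z v x + christoffel G z v x'.
  by move=> Dz; have := christoffel_linear_r GM 1 v x x' Dz; rewrite !scale1r.
have alg (a a1 a2 b b1 b2 c c1 c2 d d1 d2 : 'rV[R]_n) : a = a1 + a2 -> b = b1 + b2 ->
    c = c1 + c2 -> d = d1 + d2 ->
    a - b + (c - d) = (a1 - b1 + (c1 - d1)) + (a2 - b2 + (c2 - d2)).
  move=> -> -> -> ->; by apply/matrixP => i j; rewrite !mxE; ring.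
have dG p q : differentiable (fun z => christoffel G z p q) y.
  exact: (christoffel_differentiable GM _ _ Dy).
apply: alg.
- have := deriveDv 1 u u' (dG v w); rewrite !scale1r; exact.
- have e : \forall z \near y, christoffel G z (u + u') w
      = christoffel G z u w + christoffel G z u' w.
    by apply: (open_near Do Dy) => z Dz; exact: Gl.
  apply: etrans (near_eq_derive v e) _.
  exact: (deriveD (diff_derivable (dG u w)) (diff_derivable (dG u' w))).
- exact: Gl.
- by rewrite (Gl _ _ Dy); exact: Gr.
Qed.

(** Differentiating <w, x> for constant fields along v and then u, the curvature
    terms measure the failure of the two derivatives to commute, which is zero. *)
Lemma riemann_skew34 u v w x y : D y ->
  inner (G y) (riemann G y u v w) x = - inner (G y) (riemann G y u v x) w.
Proof.
move=> Dy.
have alg (q : 'rV[R]_n -> 'rV[R]_n -> R) Rw Rx a1 a2 b1 b2 c1 c2 d1' d2' :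
    inner_product q -> Rw = a1 - a2 -> Rx = b1 - b2 ->
    q a1 x + q c1 d1' + (q c2 d2' + q w b1) = q a2 x + q c2 d2' + (q c1 d1' + q w b2) ->
    q Rw x = - q Rx w.
  move=> qP -> ->; rewrite !(ipE qP) (ipC qP w b1) (ipC qP w b2); lra.
have gP := metricP GM.
pose s : 'rV[R]_n -> 'rV[R]_n := cst w; pose t : 'rV[R]_n -> 'rV[R]_n := cst x.
have s2 : twice_differentiable D s := twice_differentiable_cst w.
have t2 : twice_differentiable D t := twice_differentiable_cst x.
pose f y := inner (G y) w x : R.
have id2 := twice_differentiable_id.
have compat := cov_compat GM (U := D) (phi := fun x => x) (fun _ h => h) id2.
have dcv := cov_differentiable GM Do (phi := fun x => x) (fun _ h => h) id2.
have f1 a z : D z -> 'D_a f z = inner (G z) (cv s a z) x + inner (G z) w (cv t a z).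
  by move=> Dz; exact: (compat s t a z Dz (s2.1 z Dz) (t2.1 z Dz)).
have dG z : D z -> differentiable G z := metric_differentiable GM (y := z).
have dI (p q : 'rV[R]_n -> 'rV[R]_n) z : D z -> differentiable p z -> differentiable q z ->
    differentiable (fun z => inner (G z) (p z) (q z) : R) z.
  by move=> Dz dp dq; exact: (differentiable_inner (dG z Dz) dp dq).
have df z : D z -> differentiable f z.
  by move=> Dz; exact: (dI s t z Dz (s2.1 z Dz) (t2.1 z Dz)).
have d1 a z : D z -> differentiable (fun z => inner (G z) (cv s a z) x : R) z.
  by move=> Dz; exact: (dI (cv s a) t z Dz (dcv s a z s2 Dz) (t2.1 z Dz)).
have d2 a z : D z -> differentiable (fun z => inner (G z) w (cv t a z) : R) z.
  by move=> Dz; exact: (dI s (cv t a) z Dz (s2.1 z Dz) (dcv t a z t2 Dz)).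
have nf a : \forall z \near y,
    inner (G z) (cv s a z) x + inner (G z) w (cv t a z) = 'D_a f z.
  by apply: (open_near Do Dy) => z Dz; rewrite f1.
have ddf a : differentiable ('D_a f) y.
  apply: differentiable_near_eq (nf a) _.
  exact: (differentiableD (d1 a y Dy) (d2 a y Dy)).
have f2 a b : 'D_b ('D_a f) y =
   (inner (G y) (cv (cv s a) b y) x + inner (G y) (cv s a y) (cv t b y)) +
   (inner (G y) (cv s b y) (cv t a y) + inner (G y) w (cv (cv t a) b y)).
  apply: etrans (esym (near_eq_derive b (nf a))) _.
  apply: etrans (deriveD (diff_derivable (d1 a y Dy)) (diff_derivable (d2 a y Dy))) _.
  apply: (congr2 (fun a b : R => a + b)).
    exact: (compat (cv s a) t b y Dy (dcv s a y s2 Dy) (t2.1 y Dy)).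
  exact: (compat s (cv t a) b y Dy (s2.1 y Dy) (dcv t a y t2 Dy)).
have e : 'D_u ('D_v f) y = 'D_v ('D_u f) y.
  exact: (mixed_derivativesC (open_near Do Dy df) (ddf v) (ddf u)).
apply: (alg _ _ _ _ _ _ _ _ _ _ _ (gP y Dy)
  (riemann_cov u v s2 Dy) (riemann_cov u v t2 Dy)).
exact: (etrans (esym (f2 v u)) (etrans e (f2 u v))).
Qed.

Lemma riemann_symmetries y : D y -> curvature_symmetries
  (fun u v w x => inner (G y) (riemann G y u v w) x).
Proof.
move=> Dy; have gP := metricP GM Dy; split=> [u u' v w x|u v w x|u v w x|u v w x].
- by rewrite (riemannDl _ _ _ _ Dy) (ipDl gP).
- by rewrite (riemann_skew12 _ _ _ Dy) (ipNl gP).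
- exact: riemann_skew34.
- by rewrite -!(ipDl gP) (riemann_bianchi _ _ _ Dy) (ip0l gP).
Qed.

End AmbientCurvature.

(** The last condition is the equation nabla J = 0 on constant fields. *)
Definition local_kaehler (R : realType) (n : nat) (D : set 'rV[R]_n)
    (G J : 'rV[R]_n -> 'M[R]_n) : Prop :=
  [/\ smooth D J, forall y, D y -> J y *m J y = - 1%:M,
      forall y u v, D y -> inner (G y) (u *m J y) (v *m J y) = inner (G y) u v
    & forall y e w, D y -> w *m 'D_e J y + christoffel G y e (w *m J y)
                           = christoffel G y e w *m J y].

Lemma cov_near_eq (R : realType) (m n : nat) (G : 'rV[R]_n -> 'M[R]_n)
    (phi s t : 'rV[R]_m -> 'rV[R]_n) v z :
  (\near z, s z = t z) -> cov G phi s v z = cov G phi t v z.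
Proof.
move=> st; rewrite /cov (near_eq_derive v st).
by rewrite (nbhs_singleton st).
Qed.

Section KaehlerAlong.
Variables (R : realType) (m n : nat) (D : set 'rV[R]_n) (G J : 'rV[R]_n -> 'M[R]_n).
Hypothesis JK : local_kaehler D G J.
Variables (U : set 'rV[R]_m) (phi : 'rV[R]_m -> 'rV[R]_n).
Hypotheses (Uo : open U) (phiU : forall z, U z -> D (phi z)).
Hypothesis phi2 : twice_differentiable U phi.
Implicit Types (s : 'rV[R]_m -> 'rV[R]_n) (v z : 'rV[R]_m).

Lemma acs_along_differentiable s z : U z -> differentiable s z ->
  differentiable (fun y => s y *m J (phi y)) z.
Proof.
move=> Uz ds; apply: differentiable_mulmx => //.
apply: (differentiable_comp (phi2.1 z Uz)).
by apply: smooth_differentiable (phiU Uz); case: JK.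
Qed.

Lemma cov_acs s v z : U z -> differentiable s z ->
  cov G phi (fun y => s y *m J (phi y)) v z = cov G phi s v z *m J (phi z).
Proof.
move=> Uz ds; have Dz := phiU Uz.
have dJ : differentiable J (phi z).
  by apply: smooth_differentiable Dz; case: JK.
have dJphi := differentiable_comp (phi2.1 z Uz) dJ.
have e1 : 'D_v (fun y => s y *m J (phi y)) z
    = 'D_v s z *m J (phi z) + s z *m 'D_('D_v phi z) J (phi z).
  apply: etrans (derive_mulmx v ds dJphi) _.
  exact: (congr1 (fun X => 'D_v s z *m J (phi z) + s z *m X)
    (derive_comp v (phi2.1 z Uz) dJ)).
have [_ _ _ par] := JK.
have alg (x p q g g' : 'rV[R]_n) (J' : 'M[R]_n) : x = p *m J' + q ->
    q + g = g' *m J' -> x + g = (p + g') *m J'.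
  by move=> -> e; rewrite -addrA e mulmxDl.
exact: (alg _ _ _ _ _ _ e1 (par _ _ _ Dz)).
Qed.

End KaehlerAlong.

Section SpaceForm.
Variables (R : realType) (n : nat) (D : set 'rV[R]_n) (G J : 'rV[R]_n -> 'M[R]_n).
Hypotheses (GM : local_metric D G) (JK : local_kaehler D G J).
Let Do : open D. Proof. exact: local_metric_open GM. Qed.
Implicit Types (u v w x y : 'rV[R]_n).

(** The curvature is a commutator of covariant derivatives, which commute with J. *)
Lemma riemann_acs u v w y : D y ->
  riemann G y u v (w *m J y) = riemann G y u v w *m J y.
Proof.
move=> Dy; have id2 := @twice_differentiable_id R n D.
have phiD z : D z -> D z by [].
have dJ z : D z -> differentiable J z.
  by apply: smooth_differentiable; case: JK.
have dDJ a z : D z -> differentiable ('D_a J) z.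
  by apply: smooth_differentiable; apply: smooth_derive; case: JK.
pose s z : 'rV[R]_n := w *m J z; pose t : 'rV[R]_n -> 'rV[R]_n := cst w.
have dt z : differentiable t z by exact: differentiable_cst.
have t2 : twice_differentiable D t := twice_differentiable_cst D w.
have ds z : D z -> differentiable s z.
  by move=> Dz; exact: (differentiable_mulmx (dt z) (dJ z Dz)).
have Ds a z : D z -> w *m 'D_a J z = 'D_a s z.
  move=> Dz; have := derive_mulmx a (dt z) (dJ z Dz).
  by rewrite derive_cst mul0mx add0r => ->.
have s2 : twice_differentiable D s.
  split=> [|a z Dz]; first exact: ds.
  apply: (differentiable_near_eq (open_near Do Dz (Ds a))).
  exact: (differentiable_mulmx (dt z) (dDJ a z Dz)).
have cvs a z : D z -> cov G id s a z = cov G id t a z *m J z.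
  by move=> Dz; exact: (@cov_acs _ _ _ _ _ _ JK D id phiD id2 t a z Dz (dt z)).
have dcv a z : D z -> differentiable (cov G id t a) z.
  by move=> Dz; exact: (@cov_differentiable _ _ _ _ _ GM D id Do phiD id2 t a z t2 Dz).
have cvcvs a b : cov G id (cov G id s a) b y = cov G id (cov G id t a) b y *m J y.
  apply: etrans (cov_near_eq G id b (open_near Do Dy (cvs a))) _.
  exact: (@cov_acs _ _ _ _ _ _ JK D id phiD id2 _ b y Dy (dcv a y Dy)).
apply: etrans (riemann_cov GM u v s2 Dy) _.
apply: etrans (congr2 (fun a b : 'rV[R]_n => a - b) (cvcvs v u) (cvcvs u v)) _.
apply: etrans (congr1 (fun a => a *m J y) (esym (riemann_cov GM u v t2 Dy))).
by rewrite mulmxBl.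
Qed.

Variable c : R.
Hypothesis hol : forall y u, D y -> u != 0 ->
  sectional_curvature G y u (u *m J y) = 4 * c.

Lemma space_form_riemann y u v w x : D y ->
  inner (G y) (riemann G y u v w) x
    = model_curvature (inner (G y)) (mulmxr (J y)) c u v w x.
Proof.
move=> Dy; have gP := metricP GM Dy; have [_ /(_ y Dy) JJ JI _] := JK.
have JJ' (a : 'rV[R]_n) : mulmxr (J y) (mulmxr (J y) a) = - a.
  by rewrite /= -mulmxA JJ mulmxN mulmx1.
have JI' (a b : 'rV[R]_n) : inner (G y) (mulmxr (J y) a) (mulmxr (J y) b) = inner (G y) a b.
  exact: JI.
have TJ a b p q : inner (G y) (riemann G y a b (mulmxr (J y) p)) (mulmxr (J y) q)
    = inner (G y) (riemann G y a b p) q.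
  by apply: etrans (congr1 (fun z => inner (G y) z _) (riemann_acs a b p Dy)) _; exact: JI.
have TH a : inner (G y) (riemann G y a (mulmxr (J y) a) (mulmxr (J y) a)) a
    = 4 * c * inner (G y) a a ^+ 2.
  have [->|a0] := eqVneq a 0.
    by rewrite !(ip0l gP, ip0r gP) expr0n /= mulr0.
  have aJ : inner (G y) a (a *m J y) = 0.
    by have := @ipJC _ _ _ (mulmxr (J y)) gP JJ' JI' a a; rewrite /= (ipC gP a); lra.
  have := hol Dy a0; rewrite /sectional_curvature (JI _ _ _ Dy) aJ expr0n /= subr0.
  move=> <-; rewrite -expr2 divfK// expf_neq0//.
  by rewrite gt_eqF// (ip_gt0 gP).
have := @space_form_curvature _ _ _ (mulmxr (J y)) c gP JJ' JI' _
  (riemann_symmetries GM Dy) TJ TH.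
by move=> e; exact: (congr1 (fun T => T u v w x) e).
Qed.

End SpaceForm.

(** * Submanifolds at a point *)

Section SubmanifoldAtPoint.
Variables (R : rcfType) (V E : lmodType R) (q : E -> E -> R).
Variables (iota : {linear V -> E}) (J : {linear E -> E}) (xi : E) (c : R).
Variables (F A : {linear V -> V}) (U : V).
Variables (C : V -> V -> E) (Gamma : V -> V -> V) (Rm : V -> V -> V -> V).

Let g x y := q (iota x) (iota y).

Hypotheses (qP : inner_product q) (JJ : forall x, J (J x) = - x).
Hypothesis qJ : forall x y, q (J x) (J y) = q x y.
Hypothesis iota_inj : forall x, iota x = 0 -> x = 0.
Hypotheses (xi_unit : q xi xi = 1) (xi_normal : forall x, q (iota x) xi = 0).
Hypothesis J_iota : forall x, J (iota x) = iota (F x) + q (iota x) (iota U) *: xi.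
Hypothesis iota_U : iota U = - J xi.

Lemma induced_inner_product : inner_product g.
Proof.
split=> [x y|a x y z|x x0].
- exact: ipC qP _ _.
- by rewrite /g linearP (ipDl qP) (ipZl qP).
- by apply: (ip_gt0 qP); apply: contra_neq x0; exact: iota_inj.
Qed.
Let gP := induced_inner_product.

Let iota_injective x y : iota x = iota y -> x = y.
Proof.
move=> e; apply/eqP; rewrite -subr_eq0; apply/eqP/iota_inj.
by rewrite linearB e subrr.
Qed.

Lemma structure_unit : g U U = 1.
Proof. by rewrite /g iota_U (ipNl qP) (ipNr qP) opprK qJ. Qed.

Lemma structure_FU : F U = 0.
Proof.
apply: iota_inj; have := J_iota U.
rewrite {1}iota_U linearN /= JJ opprK -/(g U U) structure_unit scale1r.
by rewrite -{1}[xi]add0r => /addIr.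
Qed.

Lemma structure_FF x : F (F x) = - x + g x U *: U.
Proof.
have := JJ (iota x); rewrite J_iota linearD linearZ /= J_iota.
have -> : J xi = - iota U by rewrite iota_U opprK.
move=> e; have /(congr1 (fun y => q y xi)) := e.
rewrite !(ipDl qP) !(ipZl qP) !(ipNl qP) !xi_normal xi_unit => e'.
have FU0 : q (iota (F x)) (iota U) = 0 by lra.
apply: iota_injective; rewrite linearD linearN linearZ /=.
by move: e; rewrite FU0 scale0r addr0 scalerN => /eqP; rewrite subr_eq => /eqP.
Qed.

Lemma J_iota_tangent x y : q (J (iota x)) (iota y) = g (F x) y.
Proof.
by rewrite J_iota (ipDl qP) (ipZl qP) (ipC qP xi) xi_normal mulr0 addr0.
Qed.

Lemma structure_skew x y : g (F y) x = - g (F x) y.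
Proof. by rewrite -!J_iota_tangent; exact: (ipJC qP JJ qJ). Qed.

Hypotheses (CC : forall v w, C v w = C w v).
Hypothesis Cl : forall a u v w, C (a *: u + v) w = a *: C u w + C v w.
Hypothesis C_tangent : forall v w k, q (C v w) (iota k) = g (Gamma v w) k.
Hypothesis C_normal : forall v w, q (C v w) xi = g (A v) w.

Let h v w := C v w - iota (Gamma v w) - g (A v) w *: xi.

Lemma shape_symmetric v w : g (A v) w = g v (A w).
Proof. by rewrite -C_normal CC C_normal (ipC gP). Qed.

Lemma tangent_connectionC v w : Gamma v w = Gamma w v.
Proof. by apply: (ip_inj gP) => k; rewrite -!C_tangent CC. Qed.

Lemma tangent_connection_linear a u v w :
  Gamma (a *: u + v) w = a *: Gamma u w + Gamma v w.
Proof.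
apply: (ip_inj gP) => k; rewrite (ipDl gP) (ipZl gP) -!C_tangent Cl.
by rewrite (ipDl qP) (ipZl qP).
Qed.

Lemma normal_formC v w : h v w = h w v.
Proof. by rewrite /h CC tangent_connectionC shape_symmetric (ipC gP). Qed.

Lemma normal_form_linear a u v w : h (a *: u + v) w = a *: h u w + h v w.
Proof.
rewrite /h Cl tangent_connection_linear !linearP /= (ipDl gP) (ipZl gP).
apply: (ip_inj qP) => k; rewrite !(ipE qP); ring.
Qed.

Lemma normal_form_tangent v w k : q (h v w) (iota k) = 0.
Proof.
rewrite /h !(ipDl qP) !(ipNl qP) !(ipZl qP) C_tangent (ipC qP xi) xi_normal.
by rewrite /g; ring.
Qed.

Lemma normal_form_normal v w : q (h v w) xi = 0.
Proof.
rewrite /h !(ipDl qP) !(ipNl qP) !(ipZl qP) C_normal xi_normal xi_unit.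
by rewrite /g; ring.
Qed.

Lemma C_decomposition v w : C v w = h v w + iota (Gamma v w) + g (A v) w *: xi.
Proof. by rewrite /h addrAC subrK subrK. Qed.

Lemma orthogonal_span x t b : (forall k, q x (iota k) = 0) -> q x xi = 0 ->
  q x (iota t + b *: xi) = 0.
Proof. by move=> xt xn; rewrite (ipDr qP) (ipZr qP) xt xn mulr0 addr0. Qed.

Hypothesis JC : forall v w, exists t b,
  J (C v w) = C v (F w) + iota t + b *: xi.

(** Both sides are orthogonal to the tangent space and to xi, and by [JC] they differ
    by a vector in the span of those. *)
Lemma normal_form_acs v w : h v (F w) = J (h v w).
Proof.
have [t [b e]] := JC v w.
have [t' [b' eX]] : exists t' b', J (h v w) - h v (F w) = iota t' + b' *: xi.
  exists (t - F (Gamma v w) + Gamma v (F w) + g (A v) w *: U).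
  exists (b - g (Gamma v w) U + g (A v) (F w)).
  have -> : J (h v w) = J (C v w) - J (iota (Gamma v w)) - g (A v) w *: J xi.
    by rewrite /h !linearB linearZ.
  have -> : J xi = - iota U by rewrite iota_U opprK.
  rewrite e J_iota /h !(linearD, linearN, linearZ) /=.
  by apply: (ip_inj qP) => k; rewrite !(ipE qP) /g; ring.
have Jt k : q (J (h v w)) (iota k) = 0.
  have := ipJC qP JJ qJ (iota k) (h v w); rewrite J_iota => ->.
  rewrite (ipC qP) orthogonal_span ?oppr0// => *; first exact: normal_form_tangent.
  exact: normal_form_normal.
have Jn : q (J (h v w)) xi = 0.
  have := ipJC qP JJ qJ xi (h v w) => ->.
  have -> : J xi = - iota U by rewrite iota_U opprK.
  by rewrite (ipNl qP) (ipC qP) normal_form_tangent !oppr0.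
apply/esym/eqP; rewrite -subr_eq0; apply/eqP/(ip_eq0 qP).
rewrite [X in q _ X]eX orthogonal_span// => [k|]; rewrite (ipDl qP) (ipNl qP).
  by rewrite Jt normal_form_tangent subr0.
by rewrite Jn normal_form_normal subr0.
Qed.

Hypothesis ricci : forall v w, exists t, forall y,
  model_curvature q J c (iota v) (iota w) xi y
    = q (iota t - C v (A w) + C w (A v)) y.

(** The ambient curvature applied to xi lies in the span of the tangent space and xi;
    [ricci] computes its component orthogonal to that span. *)
Lemma normal_form_shape v w : h (A v) w = h v (A w).
Proof.
have [t e] := ricci v w; rewrite (normal_formC (A v)).
pose X := h w (A v) - h v (A w).
have Xt k : q X (iota k) = 0 by rewrite /X (ipDl qP) (ipNl qP) !normal_form_tangent subr0.
have Xn : q X xi = 0 by rewrite /X (ipDl qP) (ipNl qP) !normal_form_normal subr0.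
apply/eqP; rewrite -subr_eq0 -/X; apply/eqP/(ip_eq0 qP).
have -> : q X X = q (iota t - C v (A w) + C w (A v)) X.
  rewrite !C_decomposition {1}/X !(ipDl qP) !(ipNl qP) !(ipDl qP) !(ipZl qP).
  by rewrite !(ipC qP (iota _) X) !Xt !(ipC qP xi X) Xn; ring.
rewrite -e /model_curvature.
have JX k : q (J (iota k)) X = 0.
  by rewrite J_iota (ipC qP) orthogonal_span.
have Jxi : q (J xi) X = 0.
  by rewrite -[J xi]opprK -iota_U (ipNl qP) (ipC qP) Xt oppr0.
by rewrite !JX Jxi !(ipC qP (iota _) X) !Xt; ring.
Qed.

Hypothesis gauss : forall u v w k, g (Rm u v w) k =
  model_curvature q J c (iota u) (iota v) (iota w) (iota k)
  + (q (C v w) (C u k) - g (Gamma v w) (Gamma u k))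
  - (q (C u w) (C v k) - g (Gamma u w) (Gamma v k)).

Lemma gauss_equation u v w k :
  g (Rm u v w) k = gauss_curvature g q F A c h u v w k.
Proof.
have span (x x' : E) t t' b b' :
    q x (iota t') = 0 -> q x xi = 0 -> q x' (iota t) = 0 -> q x' xi = 0 ->
    q (x + iota t + b *: xi) (x' + iota t' + b' *: xi)
      = q x x' + q (iota t) (iota t') + b * b'.
  move=> xt xn x't x'n; rewrite !(ipE qP) xt xn xi_unit !xi_normal.
  by rewrite !(ipC qP xi) !(ipC qP (iota t) x') x't x'n !xi_normal; ring.
have CCq a b a' b' : q (C a b) (C a' b') = q (h a b) (h a' b')
    + g (Gamma a b) (Gamma a' b') + g (A a) b * g (A a') b'.
  rewrite (C_decomposition a b) (C_decomposition a' b').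
  by apply: span; rewrite ?normal_form_tangent ?normal_form_normal.
rewrite gauss /gauss_curvature /model_curvature !J_iota_tangent !CCq /g; ring.
Qed.

Hypothesis RA : forall u v w, Rm u v (A w) = A (Rm u v w).
Hypothesis c_neq0 : c != 0.

Lemma principal_structure_vector : exists lam mu : R,
  [/\ A U = lam *: U, forall z, q (iota z) (iota U) = 0 -> A z = mu *: z
    & lam = mu \/ lam * mu = - c].
Proof.
apply: (@structure_vector_principal _ _ _ g q F A U J c h gP qP).
- exact: structure_skew.
- exact: structure_FU.
- exact: structure_FF.
- exact: structure_unit.
- exact: shape_symmetric.
- exact: normal_formC.
- exact: normal_form_linear.
- exact: normal_form_acs.
- by move=> w Jw; apply: oppr_inj; rewrite -JJ Jw linear0 oppr0.
- exact: normal_form_shape.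
- by move=> x y z w; rewrite -!gauss_equation RA shape_symmetric.
- exact: c_neq0.
Qed.

End SubmanifoldAtPoint.

(** If J x has a nonzero component b along xi, then b J xi = - x - J y for the tangential
    part y of J x, and the component of J y along xi vanishes because J xi is
    orthogonal to xi. *)
Lemma structure_vector_exists (R : rcfType) (V E : lmodType R) (q : E -> E -> R)
    (iota : {linear V -> E}) (J : {linear E -> E}) (xi : E) :
  inner_product q -> (forall x, J (J x) = - x) ->
  (forall x y, q (J x) (J y) = q x y) -> q xi xi = 1 ->
  (forall x, q (iota x) xi = 0) ->
  (forall x, exists y b, J (iota x) = iota y + b *: xi) ->
  (exists x, q (J (iota x)) xi != 0) -> exists U, iota U = - J xi.
Proof.
move=> qP JJ qJ xi1 xin JT [x ux].
have [y [b e]] := JT x.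
have b0 : b != 0.
  by move: ux; rewrite e (ipDl qP) (ipZl qP) xin xi1 add0r mulr1.
have [y' [b' e']] := JT y.
have Jxi : q (J xi) xi = 0 by have := ipJC qP JJ qJ xi xi; lra.
have e2 : b *: J xi = - (iota x + iota y') - b' *: xi.
  have := JJ (iota x); rewrite e linearD linearZ /= e'.
  move=> h; apply: (addrI (iota y' + b' *: xi)); rewrite h.
  by apply: (ip_inj qP) => k; rewrite !(ipE qP); ring.
have b'0 : b' = 0.
  have := congr1 (fun v => q v xi) e2.
  by rewrite /= !(ipE qP) !xin xi1 Jxi; lra.
exists (b^-1 *: (x + y')); rewrite linearZ linearD /=.
apply: (scalerI b0); rewrite scalerA divff// scale1r scalerN e2 b'0 scale0r subr0.
by rewrite opprK.
Qed.

(** * Immersed submanifolds in a chart *)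

(** Both the Gauss equation of an immersion and its intrinsic counterpart are
    instances of this formula, in which the derivatives of the second
    fundamental form appear only through scalar functions. *)
Lemma inner_curvature (R : realType) (m n : nat) (D : set 'rV[R]_n)
    (G : 'rV[R]_n -> 'M[R]_n) (GM : local_metric D G) (U : set 'rV[R]_m)
    (phi : 'rV[R]_m -> 'rV[R]_n) (Uo : open U) (phiU : forall z, U z -> D (phi z))
    (phi2 : twice_differentiable U phi) (s t : 'rV[R]_m -> 'rV[R]_n)
    (s2 : twice_differentiable U s) (t2 : twice_differentiable U t) u v z :
  U z ->
  inner (G (phi z)) (riemann G (phi z) ('D_u phi z) ('D_v phi z) (s z)) (t z)
  = ('D_u (fun y => inner (G (phi y)) (cov G phi s v y) (t y) : R) z
       - inner (G (phi z)) (cov G phi s v z) (cov G phi t u z))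
    - ('D_v (fun y => inner (G (phi y)) (cov G phi s u y) (t y) : R) z
       - inner (G (phi z)) (cov G phi s u z) (cov G phi t v z)).
Proof.
move=> Uz; have gP := metricP GM (phiU z Uz).
have alg (q : 'rV[R]_n -> 'rV[R]_n -> R) r a b x c d p p' : inner_product q ->
    a - b = r -> p = q a x + c -> p' = q b x + d -> q r x = (p - c) - (p' - d).
  by move=> qP <- -> ->; rewrite (ipDl qP) (ipNl qP); ring.
have dcv a := cov_differentiable GM Uo phiU phi2 a s2 Uz.
apply: (alg _ _ _ _ _ _ _ _ _ gP (cov_curvature GM Uo phiU phi2 u v s2 Uz)).
  exact: (cov_compat GM phiU phi2 u Uz (dcv v) (t2.1 z Uz)).
exact: (cov_compat GM phiU phi2 v Uz (dcv u) (t2.1 z Uz)).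
Qed.

Section LinearMaps.
Variables (R : realType) (V W : lmodType R) (L : V -> W).
Hypothesis Ll : forall a x y, L (a *: x + y) = a *: L x + L y.

Lemma linear_map0 : L 0 = 0.
Proof. by have := Ll (-1) 0 0; rewrite scaler0 addr0 scaleN1r addNr. Qed.

Lemma linear_mapZ a x : L (a *: x) = a *: L x.
Proof. by rewrite -[a *: x]addr0 Ll linear_map0 addr0. Qed.

Lemma linear_mapN x : L (- x) = - L x.
Proof. by rewrite -scaleN1r linear_mapZ scaleN1r. Qed.

Lemma linear_mapB x y : L (x - y) = L x - L y.
Proof. by rewrite -{1}[x]scale1r Ll scale1r linear_mapN. Qed.

Lemma linear_mapBZ x a y : L (x - a *: y) = L x - a *: L y.
Proof. by rewrite linear_mapB linear_mapZ. Qed.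

End LinearMaps.

(** The two hypotheses on x and x' are d theta = lam d eta on the pair (V, W): x and x'
    are second covariant derivatives of s, and y, y' those of the immersion composed
    with J. *)
Lemma codazzi_algebra (R : realFieldType) (E : lmodType R) (f : E -> E -> R)
    (J : {linear E -> E}) (c lam mu : R) (V W s x x' y y' : E) :
  inner_product f -> (forall x, J (J x) = - x) ->
  (forall x y, f (J x) (J y) = f x y) -> f V s = 0 -> f W s = 0 -> f s s = 1 ->
  f V V != 0 -> W = J V -> y = y' ->
  f (x - x') (J s) = model_curvature f J c V W s (J s) ->
  f x (J s) + f (- (mu *: W)) (J (- (mu *: V)))
    = lam * (f y s + f (J W) (- (mu *: V))) ->
  f x' (J s) + f (- (mu *: V)) (J (- (mu *: W)))
    = lam * (f y' s + f (J V) (- (mu *: W))) ->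
  mu * mu - c = lam * mu.
Proof.
move=> fP JJ fJ Vs Ws ss VV WE <-.
have WW : f W W = f V V by rewrite WE fJ.
have JW : J W = - V by rewrite WE JJ.
have -> : J (- (mu *: V)) = - (mu *: W) by rewrite linearN linearZ /= -WE.
have -> : J (- (mu *: W)) = mu *: V by rewrite linearN linearZ /= JW scalerN opprK.
rewrite /model_curvature -WE JW (fJ s s) ss !(ipE fP) WW Vs Ws => h h1 h2.
by apply: (mulIf VV); lra.
Qed.

Lemma principal_curvatures_flat (R : realFieldType) (c lam mu : R) :
  mu * mu - c = lam * mu -> lam = mu \/ lam * mu = - c -> c = 0.
Proof.
move=> key [e|e]; first by rewrite e in key; lra.
have mu0 : mu = 0 by apply/eqP; rewrite -sqrf_eq0 expr2; apply/eqP; lra.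
by rewrite mu0 mulr0 in e; lra.
Qed.

Section LocalSubmanifold.
Variables (R : realType) (m n : nat) (c : R).
Variables (D : set 'rV[R]_n) (Gb J : 'rV[R]_n -> 'M[R]_n).
Hypotheses (GM : local_metric D Gb) (JK : local_kaehler D Gb J).
Hypothesis hol : forall y u, D y -> u != 0 ->
  sectional_curvature Gb y u (u *m J y) = 4 * c.
Variables (U : set 'rV[R]_m) (G : 'rV[R]_m -> 'M[R]_m).
Hypothesis gM : local_metric U G.
Variables (phi s : 'rV[R]_m -> 'rV[R]_n) (A : 'rV[R]_m -> 'rV[R]_m -> 'rV[R]_m).
Hypotheses (phis : smooth U phi) (ss : smooth U s).
Hypothesis phiU : forall z, U z -> D (phi z).
Implicit Types (z u v w k : 'rV[R]_m).

Let q z := inner (Gb (phi z)).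
Let C z v w := cov Gb phi ('D_w phi) v z.

Hypothesis hG : forall z v w, U z ->
  inner (G z) v w = inner (Gb (phi z)) ('D_v phi z) ('D_w phi z).
Hypothesis s_unit : forall z, U z -> inner (Gb (phi z)) (s z) (s z) = 1.
Hypothesis s_normal : forall z v, U z -> inner (Gb (phi z)) ('D_v phi z) (s z) = 0.
Hypothesis JT : forall z v, U z -> exists w b,
  'D_v phi z *m J (phi z) = 'D_w phi z + b *: s z.
Hypothesis ux : forall z, U z -> exists v,
  inner (Gb (phi z)) ('D_v phi z *m J (phi z)) (s z) != 0.
Hypothesis sA : forall z v, U z -> cov Gb phi s v z = - 'D_(A z v) phi z.
Hypothesis RA : forall z u v w, U z ->
  riemann G z u v (A z w) = A z (riemann G z u v w).

Let Uo : open U. Proof. exact: local_metric_open gM. Qed.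
Let phi2 : twice_differentiable U phi. Proof. exact: smooth_twice. Qed.
Let E2 w : twice_differentiable U ('D_w phi).
Proof. by apply: smooth_twice; exact: smooth_derive. Qed.
Let s2 : twice_differentiable U s. Proof. exact: smooth_twice. Qed.
Let qP z : U z -> inner_product (q z).
Proof. by move=> Uz; exact: (metricP GM (phiU Uz)). Qed.
Let gP z : U z -> inner_product (inner (G z)).
Proof. by move=> Uz; exact: (metricP gM Uz). Qed.
Let phi_linear z a v w : U z ->
  'D_(a *: v + w) phi z = a *: 'D_v phi z + 'D_w phi z.
Proof. by move=> Uz; exact: (deriveDv a v w (phi2.1 z Uz)). Qed.

Lemma second_formC z v w : U z -> C z v w = C z w v.
Proof. by move=> Uz; exact: (cov_torsion GM Uo phiU phi2 v w Uz). Qed.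

Lemma second_form_linear z a u v w : U z ->
  C z (a *: u + v) w = a *: C z u w + C z v w.
Proof. by move=> Uz; exact: (cov_linear GM phiU phi2 a u v Uz ((E2 w).1 z Uz)). Qed.

Lemma derive_induced_metric z v w k : U z -> inner ('D_v G z) w k
  = q z (C z v w) ('D_k phi z) + q z ('D_w phi z) (C z v k).
Proof.
move=> Uz; have dG := metric_differentiable gM Uz.
have dc (x : 'rV[R]_m) : differentiable (cst x : 'rV[R]_m -> 'rV[R]_m) z.
  exact: differentiable_cst.
have e1 := derive_inner v dG (dc w) (dc k).
have e2 : \forall y \near z, inner (G y) w k
    = inner (Gb (phi y)) ('D_w phi y) ('D_k phi y).
  by apply: (open_near Uo Uz) => y Uy; exact: hG.
have e3 := cov_compat GM phiU phi2 v Uz ((E2 w).1 z Uz) ((E2 k).1 z Uz).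
apply: etrans _ (etrans (near_eq_derive v e2) e3).
apply: etrans _ (esym e1); rewrite !derive_cst.
by rewrite (ip0l (gP Uz)) (ip0r (gP Uz)) !addr0.
Qed.

(** Both sides are given by the Koszul formula of the induced metric. *)
Lemma second_form_tangent z v w k : U z ->
  q z (C z v w) ('D_k phi z) = inner (G z) (christoffel G z v w) k.
Proof.
move=> Uz; apply: etrans _ (esym (koszul gM v w k Uz)).
rewrite !(derive_induced_metric _ _ _ Uz).
rewrite (second_formC v w Uz) (second_formC k w Uz) (second_formC k v Uz).
have alg (f : 'rV[R]_n -> 'rV[R]_n -> R) c1 c2 c3 e1 e2 e3 : inner_product f ->
    f c1 e3 = 2^-1 * (f c1 e3 + f e2 c2 + (f c1 e3 + f e1 c3) - (f c2 e2 + f e1 c3)).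
  by move=> fP; rewrite (ipC fP c2); field.
exact: (alg (q z) (C z w v) (C z v k) (C z w k) ('D_v phi z) ('D_w phi z)
  ('D_k phi z) (qP Uz)).
Qed.

(** Derivative of <'D_w phi, s> = 0. *)
Lemma second_form_normal z v w : U z ->
  q z (C z v w) (s z) = inner (G z) (A z v) w.
Proof.
move=> Uz.
have e1 : \forall y \near z, (0 : R) = inner (Gb (phi y)) ('D_w phi y) (s y).
  by apply: (open_near Uo Uz) => y Uy; rewrite s_normal.
have := cov_compat GM phiU phi2 v Uz ((E2 w).1 z Uz) (s2.1 z Uz).
rewrite -(near_eq_derive v e1) derive_cst sA// => e.
have alg (f : 'rV[R]_n -> 'rV[R]_n -> R) x y a b : inner_product f ->
    0 = f x y + f a (- b) -> f x y = f b a.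
  by move=> fP; rewrite (ipNr fP) (ipC fP a); lra.
rewrite (hG _ _ Uz); exact: (alg _ _ _ _ _ (qP Uz) e).
Qed.

(** The tangential part of x, written so that its regularity in z is that of the
    metrics and of phi. *)
Let tangent z (x : 'rV[R]_n) : 'rV[R]_m :=
  (\row_k inner (Gb (phi z)) x ('D_(delta_mx 0 k) phi z)) *m invmx (G z).

Lemma tangentE z x k : U z ->
  inner (G z) (tangent z x) k = q z x ('D_k phi z).
Proof.
move=> Uz; apply: (@inner_row_invmx _ _ (G z) (fun k => q z x ('D_k phi z))).
  exact: inner_unitmx (gP Uz).
move=> a v w; rewrite (phi_linear a v w Uz).
by rewrite (ipDr (qP Uz)) (ipZr (qP Uz)).
Qed.

Lemma tangent_unique z x t : U z ->
  (forall k, q z x ('D_k phi z) = q z ('D_t phi z) ('D_k phi z)) -> tangent z x = t.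
Proof.
move=> Uz h; apply: (ip_inj (gP Uz)) => k.
by rewrite (tangentE _ _ Uz) h; exact: (esym (hG _ _ Uz)).
Qed.

Lemma tangent_differentiable (x : 'rV[R]_m -> 'rV[R]_n) z : U z ->
  differentiable x z -> differentiable (fun y => tangent y (x y)) z.
Proof.
move=> Uz dx; apply: differentiable_mulmx; last first.
  apply: differentiable_invmx; first exact: (metric_differentiable gM Uz).
  exact: inner_unitmx (gP Uz).
apply: differentiable_mx => i k.
have := differentiable_inner (metric_along_differentiable GM phiU phi2 Uz) dx
  ((E2 (delta_mx 0 k)).1 z Uz).
by apply: differentiable_near_eq; near=> y; rewrite mxE.
Unshelve. all: by end_near. Qed.

Let F z v := tangent z ('D_v phi z *m J (phi z)).
Let eta z v := q z ('D_v phi z *m J (phi z)) (s z).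

Lemma acs_decomposition z v : U z ->
  'D_v phi z *m J (phi z) = 'D_(F z v) phi z + eta z v *: s z.
Proof.
move=> Uz; have [w [b e]] := JT v Uz.
have -> : eta z v = b.
  rewrite /eta e (ipDl (qP Uz)) (ipZl (qP Uz)) [q z (s z) _]s_unit//.
  by rewrite [q z _ (s z)]s_normal// add0r mulr1.
have -> : F z v = w; last exact: e.
apply: tangent_unique => // k; rewrite e (ipDl (qP Uz)) (ipZl (qP Uz)).
by rewrite (ipC (qP Uz) (s z)) [q z _ (s z)]s_normal// mulr0 addr0.
Qed.

Lemma acs_frame_differentiable z v : U z ->
  differentiable (fun y => 'D_v phi y *m J (phi y)) z.
Proof. by move=> Uz; exact: (acs_along_differentiable JK phiU phi2 Uz ((E2 v).1 z Uz)). Qed.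

Lemma structure_tensor_differentiable z v : U z -> differentiable (F ^~ v) z.
Proof.
by move=> Uz; exact: (tangent_differentiable Uz (acs_frame_differentiable v Uz)).
Qed.

Lemma eta_differentiable z v : U z -> differentiable (eta ^~ v) z.
Proof.
move=> Uz; exact: (differentiable_inner (metric_along_differentiable GM phiU phi2 Uz)
  (acs_frame_differentiable v Uz) (s2.1 z Uz)).
Qed.

Lemma shape_tangent z v : U z -> A z v = tangent z (- cov Gb phi s v z).
Proof.
by move=> Uz; apply/esym; apply: tangent_unique => // k; rewrite sA// opprK.
Qed.

Lemma shape_differentiable z v : U z -> differentiable (A ^~ v) z.
Proof.
move=> Uz.
have e : \forall y \near z, tangent y (- cov Gb phi s v y) = A y v.
  by apply: (open_near Uo Uz) => y Uy; rewrite shape_tangent.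
apply: (differentiable_near_eq e).
apply: (@tangent_differentiable (fun y => - cov Gb phi s v y)) => //.
exact: (differentiableN (cov_differentiable GM Uo phiU phi2 v s2 Uz)).
Qed.

(** Covariant derivative of [acs_decomposition]. *)
Lemma second_form_acs z v w : U z -> exists t b,
  C z v w *m J (phi z) = C z v (F z w) + 'D_t phi z + b *: s z.
Proof.
move=> Uz.
have e1 := cov_acs JK phiU phi2 v Uz ((E2 w).1 z Uz).
have e2 : \forall y \near z, 'D_w phi y *m J (phi y)
    = 'D_(F y w) phi y + eta y w *: s y.
  by apply: (open_near Uo Uz) => y Uy; exact: acs_decomposition.
have [d3 e3] := cov_pushforward Gb Uo phi2 v Uz (structure_tensor_differentiable w Uz).
have [d4 e4] := cov_scale GM phiU v Uz (eta_differentiable w Uz) (s2.1 z Uz).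
have e5 := cov_add GM phiU v Uz d3 d4.
exists ('D_v (F ^~ w) z - eta z w *: A z v), ('D_v (eta ^~ w) z).
apply: etrans (esym e1) _.
apply: etrans (cov_near_eq Gb phi v e2) _; apply: etrans e5 _.
apply: etrans (congr2 (fun a b : 'rV[R]_n => a + b) e3 e4) _.
have -> : 'D_('D_v (F ^~ w) z - eta z w *: A z v) phi z
    = 'D_('D_v (F ^~ w) z) phi z + eta z w *: (- 'D_(A z v) phi z).
  rewrite scalerN.
  exact: (linear_mapBZ (fun a v w => phi_linear a v w Uz)).
rewrite (sA _ Uz).
have alg (a b x y : 'rV[R]_n) : a + b + (x + y) = b + (a + y) + x.
  by rewrite (addrC a b) -!addrA; congr (_ + (_ + _)); rewrite addrC.
exact: alg.
Qed.

(** Since s is parallel, cov s w is tangent, and the ambient curvature applied to s is a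
    commutator of covariant derivatives of tangent fields. *)
Lemma second_form_ricci z v w : U z -> exists t, forall y,
  model_curvature (q z) (mulmxr (J (phi z))) c ('D_v phi z) ('D_w phi z) (s z) y
    = q z ('D_t phi z - C z v (A z w) + C z w (A z v)) y.
Proof.
move=> Uz; have Dz := phiU Uz.
have dNA (x : 'rV[R]_m) : differentiable (fun y => - A y x) z.
  exact: (differentiableN (shape_differentiable x Uz)).
have e1 (x : 'rV[R]_m) : \forall y \near z, cov Gb phi s x y = 'D_(- A y x) phi y.
  apply: (open_near Uo Uz) => y Uy; rewrite sA//.
  exact: (esym (linear_mapN (fun a v w => phi_linear a v w Uy) (A y x))).
have CN x y : C z x (- y) = - C z x y.
  rewrite (second_formC _ _ Uz) (second_formC x y Uz).
  exact: (linear_mapN (fun a v w => second_form_linear a v w x Uz) y).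
have e2 (x y : 'rV[R]_m) : cov Gb phi (cov Gb phi s y) x z
    = 'D_('D_x (fun z => - A z y) z) phi z - C z x (A z y).
  apply: etrans (cov_near_eq Gb phi x (e1 y)) _.
  have [_ ->] := cov_pushforward Gb Uo phi2 x Uz (dNA y).
  by rewrite -/(C z x (- A z y)) CN.
exists ('D_v (fun z => - A z w) z - 'D_w (fun z => - A z v) z) => y.
apply: etrans (esym (space_form_riemann GM JK hol _ _ _ _ Dz)) _.
apply: (congr1 (fun x => q z x y)).
apply: etrans (esym (cov_curvature GM Uo phiU phi2 v w s2 Uz)) _.
apply: etrans (congr2 (fun a b : 'rV[R]_n => a - b) (e2 v w) (e2 w v)) _.
set t1 := 'D_v _ z; set t2 := 'D_w _ z.
have -> : 'D_(t1 - t2) phi z = 'D_t1 phi z - 'D_t2 phi z.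
  exact: (linear_mapB (fun a v w => phi_linear a v w Uz) t1 t2).
have alg (a b x y' : 'rV[R]_n) : a - x - (b - y') = a - b - x + y'.
  by rewrite opprB addrA addrAC [a - x - b]addrAC addrAC.
exact: alg.
Qed.

(** By [inner_curvature] for phi and for the identity map of U: the functions that
    are differentiated coincide by [second_form_tangent]. *)
Lemma induced_gauss z u v w k : U z ->
  inner (G z) (riemann G z u v w) k
  = model_curvature (q z) (mulmxr (J (phi z))) c
      ('D_u phi z) ('D_v phi z) ('D_w phi z) ('D_k phi z)
    + (q z (C z v w) (C z u k)
       - inner (G z) (christoffel G z v w) (christoffel G z u k))
    - (q z (C z u w) (C z v k)
       - inner (G z) (christoffel G z u w) (christoffel G z v k)).
Proof.
move=> Uz; have Dz := phiU Uz.
have eR := inner_curvature GM Uo phiU phi2 (E2 w) (E2 k) u v Uz.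
have idU (y : 'rV[R]_m) : U y -> U y by [].
have cst2 (x : 'rV[R]_m) := twice_differentiable_cst U x.
have eG := inner_curvature gM Uo idU (twice_differentiable_id U)
  (cst2 w) (cst2 k) u v Uz.
rewrite !derive_idE in eG.
have covcst (x y z' : 'rV[R]_m) : cov G (fun y => y) (cst y) x z' = christoffel G z' x y.
  by rewrite /cov derive_cst add0r derive_idE.
have D1 (x y : 'rV[R]_m) :
   'D_x (fun z => inner (G z) (cov G (fun y => y) (cst w) y z) k : R) z
   = 'D_x (fun z => inner (Gb (phi z)) (cov Gb phi ('D_w phi) y z) ('D_k phi z) : R) z.
  apply: near_eq_derive; apply: (open_near Uo Uz) => z' Uz'.
  by rewrite covcst; apply/esym; exact: second_form_tangent.
have M := space_form_riemann GM JK hol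
  ('D_u phi z) ('D_v phi z) ('D_w phi z) ('D_k phi z) Dz.
have alg (g M' r d1 d2 c1 c2 g1 g2 d1' d2' : R) : r = M' -> d1' = d1 -> d2' = d2 ->
   r = (d1 - c1) - (d2 - c2) -> g = (d1' - g1) - (d2' - g2) ->
   g = M' + (c1 - g1) - (c2 - g2).
  by move=> <- -> -> -> ->; ring.
apply: (alg _ _ _ _ _ _ _ _ _ _ _ M (D1 u v) (D1 v u) eR).
by move: eG; rewrite !covcst; exact.
Qed.

Lemma J_square z (x : 'rV[R]_n) : U z ->
  mulmxr (J (phi z)) (mulmxr (J (phi z)) x) = - x.
Proof.
move=> Uz; have [_ /(_ _ (phiU Uz)) JJ _ _] := JK.
by rewrite /= -mulmxA JJ mulmxN mulmx1.
Qed.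

Lemma J_isometry z (x y : 'rV[R]_n) : U z ->
  q z (mulmxr (J (phi z)) x) (mulmxr (J (phi z)) y) = q z x y.
Proof. by move=> Uz; have [_ _ JI _] := JK; exact: (JI _ x y (phiU Uz)). Qed.

Lemma differential_inj z v : U z -> 'D_v phi z = 0 -> v = 0.
Proof.
move=> Uz v0; apply: (ip_eq0 (gP Uz)); rewrite (hG _ _ Uz) v0.
exact: ip0l (qP Uz) _.
Qed.

Lemma structure_tensor_linear z a v w : U z -> F z (a *: v + w) = a *: F z v + F z w.
Proof.
move=> Uz; apply: (ip_inj (gP Uz)) => k; apply: etrans (tangentE _ k Uz) _.
have alg (f : 'rV[R]_m -> 'rV[R]_m -> R) x y x' y' : inner_product f ->
    f x k = x' -> f y k = y' -> a * x' + y' = f (a *: x + y) k.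
  by move=> fP <- <-; rewrite (ipDl fP) (ipZl fP).
apply: etrans _ (alg _ _ _ _ _ (gP Uz) (tangentE _ k Uz) (tangentE _ k Uz)).
have alg' (f : 'rV[R]_n -> 'rV[R]_n -> R) (d x y k' : 'rV[R]_n) (M : 'M[R]_n) :
    inner_product f ->
    d = a *: x + y -> f (d *m M) k' = a * f (x *m M) k' + f (y *m M) k'.
  by move=> fP ->; rewrite mulmxDl -scalemxAl (ipDl fP) (ipZl fP).
exact: (alg' _ _ _ _ _ _ (qP Uz) (phi_linear a v w Uz)).
Qed.

Lemma shape_linear z a v w : U z -> A z (a *: v + w) = a *: A z v + A z w.
Proof.
move=> Uz; apply: (ip_inj (gP Uz)) => k.
rewrite (ipDl (gP Uz)) (ipZl (gP Uz)) -!(second_form_normal _ _ Uz).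
by rewrite (second_form_linear _ _ _ _ Uz) (ipDl (qP Uz)) (ipZl (qP Uz)).
Qed.

Lemma structure_vector z : U z -> exists o, 'D_o phi z = - (s z *m J (phi z)).
Proof.
move=> Uz.
pose iota : {linear 'rV[R]_m -> 'rV[R]_n} := HB.pack (fun v => 'D_v phi z)
  (GRing.isLinear.Build _ _ _ _ (fun v => 'D_v phi z) (fun a v w => phi_linear a v w Uz)).
apply: (@structure_vector_exists _ _ _ (q z) iota (mulmxr (J (phi z))) (s z)).
- exact: qP.
- by move=> x; exact: J_square.
- by move=> x y; exact: J_isometry.
- exact: s_unit.
- by move=> v; exact: s_normal.
- by move=> v; exact: JT.
- exact: ux.
Qed.

Lemma principal_at z o : U z -> c != 0 -> 'D_o phi z = - (s z *m J (phi z)) ->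
  exists lam mu : R,
  [/\ A z o = lam *: o, forall k, inner (G z) k o = 0 -> A z k = mu *: k
    & lam = mu \/ lam * mu = - c].
Proof.
move=> Uz c0 oE.
pose iota : {linear 'rV[R]_m -> 'rV[R]_n} := HB.pack (fun v => 'D_v phi z)
  (GRing.isLinear.Build _ _ _ _ (fun v => 'D_v phi z) (fun a v w => phi_linear a v w Uz)).
pose FL : {linear 'rV[R]_m -> 'rV[R]_m} := HB.pack (F z)
  (GRing.isLinear.Build _ _ _ _ (F z) (fun a v w => structure_tensor_linear a v w Uz)).
pose AL : {linear 'rV[R]_m -> 'rV[R]_m} := HB.pack (A z)
  (GRing.isLinear.Build _ _ _ _ (A z) (fun a v w => shape_linear a v w Uz)).
have JJz (x : 'rV[R]_n) : mulmxr (J (phi z)) (mulmxr (J (phi z)) x) = - x.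
  exact: J_square.
have Jiz (x y : 'rV[R]_n) :
  q z (mulmxr (J (phi z)) x) (mulmxr (J (phi z)) y) = q z x y by exact: J_isometry.
have etaE v : eta z v = q z ('D_v phi z) ('D_o phi z).
  rewrite oE (ipNr (qP Uz)).
  have := ipJC (J := mulmxr (J (phi z))) (qP Uz) JJz Jiz ('D_v phi z) (s z).
  by rewrite (ipC (qP Uz)) /= => ->; rewrite opprK.
have [lam [mu [l1 l2 l3]]] := @principal_structure_vector _ _ _ (q z) iota
  (mulmxr (J (phi z))) (s z) c FL AL o (C z) (christoffel G z) (riemann G z)
  (qP Uz) JJz Jiz
  (fun v => differential_inj Uz) (s_unit Uz) (fun v => s_normal v Uz)
  (fun v => etrans (acs_decomposition v Uz) (congr1 (fun b => _ + b *: _) (etaE v)))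
  oE (fun v w => second_formC v w Uz) (fun a u v w => second_form_linear a u v w Uz)
  (fun v w k => etrans (second_form_tangent v w k Uz) (hG _ _ Uz))
  (fun v w => etrans (second_form_normal v w Uz) (hG _ _ Uz))
  (fun v w => second_form_acs v w Uz) (fun v w => second_form_ricci v w Uz)
  (fun u v w k => etrans (esym (hG _ _ Uz)) (etrans (induced_gauss u v w k Uz)
     (congr2 (fun a b => _ + (_ - a) - (_ - b)) (hG _ _ Uz) (hG _ _ Uz))))
  (fun u v w => RA u v w Uz) c0.
exists lam, mu; split=> // k ko; apply: l2.
exact: (etrans (esym (hG _ _ Uz)) ko).
Qed.

Let hGq z v w : U z -> inner (G z) v w = q z ('D_v phi z) ('D_w phi z).
Proof. exact: hG. Qed.

(** With eta the 1-form dual to the structure vector U, theta is the one dual to A U, so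
    that U is principal exactly when theta and eta are proportional. *)
Let theta z w := q z (cov Gb phi s w z) (s z *m J (phi z)).

Lemma eta_structure_vector z o v : U z -> 'D_o phi z = - (s z *m J (phi z)) ->
  eta z v = inner (G z) v o.
Proof.
move=> Uz oE; rewrite (hGq _ _ Uz) oE (ipNr (qP Uz)).
have JJz (x : 'rV[R]_n) : mulmxr (J (phi z)) (mulmxr (J (phi z)) x) = - x.
  exact: J_square.
have Jiz (x y : 'rV[R]_n) :
  q z (mulmxr (J (phi z)) x) (mulmxr (J (phi z)) y) = q z x y by exact: J_isometry.
have := ipJC (J := mulmxr (J (phi z))) (qP Uz) JJz Jiz ('D_v phi z) (s z).
by rewrite (ipC (qP Uz)) /= => ->; rewrite opprK.
Qed.

Lemma shape_sym z v w : U z -> inner (G z) (A z v) w = inner (G z) v (A z w).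
Proof.
move=> Uz; rewrite -(second_form_normal v w Uz) (second_formC v w Uz).
by rewrite (second_form_normal w v Uz) (ipC (gP Uz)).
Qed.

Lemma theta_structure_vector z o v : U z -> 'D_o phi z = - (s z *m J (phi z)) ->
  theta z v = inner (G z) (A z v) o.
Proof.
move=> Uz oE; rewrite (hGq _ _ Uz) oE /theta (sA _ Uz) (ipNl (qP Uz)).
by rewrite (ipNr (qP Uz)).
Qed.

(** The structure vector is principal.  The cross-multiplied form avoids the principal
    curvature lam, whose differentiability would need a proof. *)
Lemma theta_eta_proportional z v o : U z -> c != 0 ->
  theta z v * eta z o = theta z o * eta z v.
Proof.
move=> Uz c0; have [x xE] := structure_vector Uz.
have [lam [mu [Ax _ _]]] := principal_at Uz c0 xE.
rewrite !(theta_structure_vector _ Uz xE) !(eta_structure_vector _ Uz xE).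
by rewrite !(shape_sym _ x Uz) Ax !(ipZr (gP Uz)); ring.
Qed.

Let sJ z := s z *m J (phi z).

Lemma sJ_differentiable z : U z -> differentiable sJ z.
Proof. by move=> Uz; exact: (acs_along_differentiable JK phiU phi2 Uz (s2.1 z Uz)). Qed.

Lemma theta_differentiable z w : U z -> differentiable (theta ^~ w) z.
Proof.
move=> Uz; exact: (differentiable_inner (metric_along_differentiable GM phiU phi2 Uz)
  (cov_differentiable GM Uo phiU phi2 w s2 Uz) (sJ_differentiable Uz)).
Qed.

Lemma theta_derive z v w : U z -> 'D_v (theta ^~ w) z
  = q z (cov Gb phi (cov Gb phi s w) v z) (sJ z)
    + q z (cov Gb phi s w z) (cov Gb phi s v z *m J (phi z)).
Proof.
move=> Uz; apply: etrans (cov_compat GM phiU phi2 v Uz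
  (cov_differentiable GM Uo phiU phi2 w s2 Uz) (sJ_differentiable Uz)) _.
exact: (congr1 (fun x => _ + q z _ x) (cov_acs JK phiU phi2 v Uz (s2.1 z Uz))).
Qed.

Lemma eta_derive z v w : U z -> 'D_v (eta ^~ w) z
  = q z (C z v w *m J (phi z)) (s z) + q z ('D_w phi z *m J (phi z)) (cov Gb phi s v z).
Proof.
move=> Uz; apply: etrans (cov_compat GM phiU phi2 v Uz
  (acs_frame_differentiable w Uz) (s2.1 z Uz)) _.
exact: (congr1 (fun x => q z x _ + _) (cov_acs JK phiU phi2 v Uz ((E2 w).1 z Uz))).
Qed.

Lemma theta_eta_proportional_derive z v w o : U z -> c != 0 ->
  theta z w * 'D_v (eta ^~ o) z + eta z o * 'D_v (theta ^~ w) z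
  = theta z o * 'D_v (eta ^~ w) z + eta z w * 'D_v (theta ^~ o) z.
Proof.
move=> Uz c0.
have dt x := diff_derivable (v := v) (theta_differentiable x Uz).
have de x := diff_derivable (v := v) (eta_differentiable x Uz).
have e : \forall y \near z, theta y w * eta y o = theta y o * eta y w.
  by apply: (open_near Uo Uz) => y Uy; exact: theta_eta_proportional.
apply: etrans (esym (deriveM (dt w) (de o))) _.
apply: etrans (near_eq_derive v e) _.
exact: (deriveM (dt o) (de w)).
Qed.

(** The identity [theta_eta_proportional_derive] is used at z for the structure vector o,
    where eta o = 1, and for the pair v, w = F v orthogonal to o, on which theta
    and eta vanish. *)
Lemma curvature_constant_eq0 z : U z ->
  (forall o, exists2 v, v != 0 & inner (G z) v o = 0) -> c = 0.
Proof.
move=> Uz dim; apply/eqP; apply: contraT => c0.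
have [u0 oE] := structure_vector Uz.
have [lam [mu [Ao Av lm]]] := principal_at Uz c0 oE.
have JJz (x : 'rV[R]_n) : mulmxr (J (phi z)) (mulmxr (J (phi z)) x) = - x.
  exact: J_square.
have Jiz (x y : 'rV[R]_n) :
  q z (mulmxr (J (phi z)) x) (mulmxr (J (phi z)) y) = q z x y by exact: J_isometry.
have [v v0 vo] := dim u0.
pose w := F z v.
have etaE x := eta_structure_vector x Uz oE.
have oo1 : inner (G z) u0 u0 = 1.
  rewrite (hGq _ _ Uz) oE (ipNl (qP Uz)) (ipNr (qP Uz)) opprK.
  by apply: etrans (Jiz (s z) (s z)) _; exact: s_unit.
have wE : 'D_w phi z = 'D_v phi z *m J (phi z).
  by rewrite (acs_decomposition v Uz) etaE vo scale0r addr0.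
have wo : inner (G z) w u0 = 0.
  rewrite (hGq _ _ Uz) wE oE (ipNr (qP Uz)).
  by rewrite [q z _ _]Jiz [q z _ _]s_normal// oppr0.
have sv : cov Gb phi s v z = - (mu *: 'D_v phi z).
  apply: etrans (sA v Uz) (congr1 -%R _).
  apply: etrans (congr1 (fun x => 'D_x phi z) (Av _ vo)) _.
  exact: (linear_mapZ (fun a v w => phi_linear a v w Uz) mu v).
have sw : cov Gb phi s w z = - (mu *: 'D_w phi z).
  apply: etrans (sA w Uz) (congr1 -%R _).
  apply: etrans (congr1 (fun x => 'D_x phi z) (Av _ wo)) _.
  exact: (linear_mapZ (fun a v w => phi_linear a v w Uz) mu w).
have th x : inner (G z) x u0 = 0 -> theta z x = 0.
  by move=> xo; rewrite (theta_structure_vector _ Uz oE) (Av _ xo) (ipZl (gP Uz)) xo mulr0.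
have tho : theta z u0 = lam.
  by rewrite (theta_structure_vector _ Uz oE) Ao (ipZl (gP Uz)) oo1 mulr1.
have D1 x y : inner (G z) y u0 = 0 -> 'D_x (theta ^~ y) z = lam * 'D_x (eta ^~ y) z.
  move=> yo; have := theta_eta_proportional_derive x y u0 Uz c0.
  by rewrite (th y yo) tho !etaE oo1 yo !mul0r mul1r add0r addr0.
have cur := cov_curvature GM Uo phiU phi2 v w s2 Uz.
have M := space_form_riemann GM JK hol ('D_v phi z) ('D_w phi z) (s z) (sJ z) (phiU Uz).
have E1 := etrans (esym (theta_derive v w Uz)) (etrans (D1 v w wo)
  (congr1 ( *%R lam) (eta_derive v w Uz))).
have E2' := etrans (esym (theta_derive w v Uz)) (etrans (D1 w v vo)
  (congr1 ( *%R lam) (eta_derive w v Uz))).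
have Cvw := second_formC v w Uz.
have vn := s_normal v Uz; have wn := s_normal w Uz.
have vv : q z ('D_v phi z) ('D_v phi z) != 0.
  by apply: lt0r_neq0; have := ip_gt0 (gP Uz) v0; rewrite (hGq v v Uz).
rewrite sv sw in E1 E2'.
have key : mu * mu - c = lam * mu.
  exact: (codazzi_algebra (J := mulmxr (J (phi z))) (qP Uz) JJz Jiz vn wn
    (s_unit Uz) vv wE (congr1 (mulmxr (J (phi z))) Cvw)
    (etrans (congr1 (fun r => q z r (sJ z)) cur) M) E1 E2').
by rewrite (principal_curvatures_flat key lm) eqxx in c0.
Qed.

End LocalSubmanifold.

(** * Reduction to charts *)

Lemma Ck_subset (R : realType) (V W : normedModType R) k (A B : set V)
    (f : V -> W) : A `<=` B -> Ck k B f -> Ck k A f.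
Proof.
move=> AB; elim: k f => [|k IH] f /=; first by move=> h x /AB; exact: h.
by move=> [df h]; split=> [x /AB|v]; [exact: df|apply: IH; exact: h].
Qed.

Lemma inner_mulmx (R : realType) (m n : nat) (F : 'M[R]_(m, n)) (G : 'M[R]_n) u v :
  inner (F *m G *m F^T) u v = inner G (u *m F) (v *m F).
Proof. by rewrite /inner trmx_mul !mulmxA. Qed.

(** Compare determinants. *)
Lemma no_odd_complex_structure (R : realFieldType) (n : nat) (K : 'M[R]_n) :
  odd n -> K *m K <> - 1%:M.
Proof.
move=> on /(congr1 determinant); rewrite det_mulmx -scaleN1r detZ det1 mulr1.
by rewrite -signr_odd on expr1 => h; have := sqr_ge0 (\det K); rewrite expr2 h; lra.
Qed.

Lemma orthogonal_vector (R : realType) (n : nat) (G : 'M[R]_n) :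
  inner_product (inner G) -> (2 <= n)%N ->
  forall o, exists2 v, v != 0 & inner G v o = 0.
Proof.
move=> GP n2 o.
pose i := Ordinal (ltnW n2); pose j := Ordinal n2.
pose a := inner G (delta_mx 0 i) o; pose b := inner G (delta_mx 0 j) o.
have [a0|a0] := eqVneq a 0.
  exists (delta_mx 0 i) => //; apply/eqP => /matrixP/(_ 0 i).
  by rewrite !mxE !eqxx => /eqP; rewrite oner_eq0.
(* The combination of two basis vectors whose products with o cancel. *)
exists (b *: delta_mx 0 i - a *: delta_mx 0 j); last first.
  by rewrite (ipDl GP) (ipNl GP) !(ipZl GP) -/a -/b; ring.
apply/eqP => /matrixP/(_ 0 j); rewrite !mxE /= mulr0 add0r mulr1.
by move=> /eqP; rewrite oppr_eq0 (negPf a0).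
Qed.

Section AmbientChart.
Variables (R : realType) (n : nat) (M : manifold R n) (g : riemannian_metric M).
Variables (J : almost_complex M) (c : R).

Lemma metric_chart a : atlas a -> local_metric (img a) (g a).
Proof.
move=> aM; split; first exact: img_open.
- exact: gram_smooth.
- by move=> y; exact: gram_sym.
- by move=> y v; exact: gram_pos.
Qed.

Lemma kaehler_chart a : kaehler J g -> atlas a -> local_kaehler (img a) (g a) (J a).
Proof.
move=> [herm par] aM; split; first exact: acs_smooth.
- by move=> y; exact: acs_sq.
- by move=> y u v iy; exact: herm.
move=> y e w iy.
have dJ := smooth_differentiable (acs_smooth J aM) iy.
have := par a aM (cst e) (cst w) (@smooth_cst _ _ _ _ _) (@smooth_cst _ _ _ _ _) y iy.
rewrite christoffel_cst => <-; rewrite /levi_civita.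
have := derive_mulmx e (@differentiable_cst _ _ _ w y) dJ.
by rewrite derive_cst mul0mx add0r => <-.
Qed.

Lemma flat_space_form : complex_space_form J g c -> c = 0 -> flat g.
Proof.
move=> [kJ hol] c0 a y aM iy u v w.
apply: (ip_nondeg (metricP (metric_chart aM) iy)) => x.
have -> := space_form_riemann (c := c) (metric_chart aM) (kaehler_chart kJ aM)
  (fun z u zi u0 => hol a z aM zi u u0) u v w x iy.
by rewrite /model_curvature c0 mul0r.
Qed.

End AmbientChart.

Section SubmanifoldChart.
Variables (R : realType) (n N : nat) (M : manifold R n) (Mb : manifold R N).
Variables (gb : riemannian_metric Mb) (J : almost_complex Mb).
Variables (g : riemannian_metric M) (f : M -> Mb) (xi : field_along f).
Variables (a : chart R n M) (b : chart R N Mb).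
Hypotheses (aM : atlas a) (bM : atlas b) (hf : immersion f).

Lemma overlap_charts z : overlap f a b z ->
  in_charts f a b (param a z) /\ a (param a z) = z.
Proof.
move=> [x [ax bx] <-]; have -> : param a (a x) = x by exact: coordK.
by split.
Qed.

Lemma overlap_open : open (overlap f a b).
Proof.
rewrite openE => _ [x [ax bx] <-]; rewrite /interior.
have ia : nbhs (a x) (a @` dom a).
  by apply: open_nbhs_nbhs; split; [exact: img_open|exists x].
have ib : nbhs (a x) [set y | dom b (f (param a y))].
  have fc := hf.1.1.
  have pc : {for a x, continuous (param a)} by exact: param_continuous.
  have nb : nbhs (f x) (dom b).
    by apply: open_nbhs_nbhs; split; [exact: dom_open|].
  have := fc x _ nb; rewrite -{1}(coordK ax) => nx.
  exact: (pc _ nx).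
apply: filterS2 ia ib => y [x' ax' <-] /=.
by rewrite coordK// => bx'; exists x'.
Qed.

Lemma local_map_smooth : smooth (overlap f a b) (local_map f a b).
Proof. by case: hf => -[_ h] _; exact: h. Qed.

Lemma local_map_img z : overlap f a b z -> img b (local_map f a b z).
Proof.
by move=> /overlap_charts[[_ _ _ bx] _]; exists (f (param a z)).
Qed.

Lemma metric_overlap : local_metric (overlap f a b) (g a).
Proof.
have sub : overlap f a b `<=` img a by move=> _ [x [ax _] <-]; exists x.
have [_ h1 h2 h3] := metric_chart g aM; split.
- exact: overlap_open.
- by move=> k; apply: Ck_subset sub _; exact: h1.
- by move=> y /sub; exact: h2.
- by move=> y v /sub; exact: h3.
Qed.

Lemma differential_derive z v : overlap f a b z ->
  'D_v (local_map f a b) z = v *m differential f a b (param a z).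
Proof.
move=> Uz; have [_ az] := overlap_charts Uz; rewrite /differential az.
by apply: deriveEjacobian; exact: smooth_differentiable local_map_smooth Uz.
Qed.

End SubmanifoldChart.

Theorem theorem2 (R : realType) (n p : nat) (c : R)
  (Mbar : manifold R (n + p)) (J : almost_complex Mbar)
  (gbar : riemannian_metric Mbar)
  (M : manifold R n) (g : riemannian_metric M)
  (f : M -> Mbar) (xi : field_along f)
  (hn : (3 <= n)%N)
  (hMbar : complex_space_form J gbar c)
  (hM : exists x : M, True)
  (hf : immersion f)
  (hg : induced_metric f g gbar)
  (hCR : maximal_CR f J)
  (hxi : distinguished_normal J gbar xi)
  (hpar : parallel_normal gbar xi)
  (hRA : RA_zero gbar xi g) :
  flat gbar /\ c = 0.
Proof.
suff c0 : c = 0 by split=> //; exact: flat_space_form hMbar c0.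
case: hM => x _.
have [a aM ax] := atlas_cover x; have [b bM bx] := atlas_cover (f x).
have [kJ hol] := hMbar; have [nu hJ] := hxi.
pose U := overlap f a b; pose phi := local_map f a b.
have Ux : U (a x) by exists x.
have gM : local_metric U (g a) by exact: metric_overlap.
have GM := metric_chart gbar bM.
have phiU z : U z -> img b (phi z) by exact: local_map_img.
have chartsU z : U z -> in_charts f a b (param a z).
  by move=> /(overlap_charts aM bM)[].
have aK z : U z -> a (param a z) = z by move=> /(overlap_charts aM bM)[].
have dphi z v : U z -> 'D_v phi z = v *m differential f a b (param a z).
  exact: differential_derive.
have qP z : U z -> inner_product (inner (gbar b (phi z))).
  by move=> Uz; exact: (metricP GM (phiU _ Uz)).
have JT z v : U z -> exists w t,
    'D_v phi z *m J b (phi z) = 'D_w phi z + t *: xi b (param a z).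
  move=> Uz; have := hJ a b _ (chartsU z Uz).
  move=> /(submx_trans (submxMl v _)) /sub_addsmxP[[w t] /= e].
  exists w, (t 0 0); rewrite !dphi// -mulmxA; apply: etrans e _; congr (_ + _).
  by rewrite {1}(mx11_scalar t) mul_scalar_mx.
apply: (@curvature_constant_eq0 _ _ _ c _ _ _ GM (kaehler_chart kJ bM)
  (fun y u iy u0 => hol b y bM iy u u0) U (g a) gM phi (xi b \o param a)
  (fun z v => shape_operator gbar xi a b (param a z) v)
  _ _ phiU _ _ _ JT _ _ _ (a x) Ux).
- exact: local_map_smooth.
- exact: comp_smooth.
- move=> z v w Uz; have := hg a b _ (chartsU z Uz); rewrite aK// => ->.
  by rewrite inner_mulmx !dphi.
- by move=> z Uz; have [] := nu a b _ (chartsU z Uz).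
- by move=> z v Uz; have [_ h] := nu a b _ (chartsU z Uz); rewrite dphi.
- move=> z Uz; set s := (_ \o _) z.
  have [//|h] := pselect
    (exists v, inner (gbar b (phi z)) ('D_v phi z *m J b (phi z)) s != 0).
  have ch := chartsU z Uz; set F := differential f a b (param a z) in dphi *.
  exfalso.
  have FJ : (F *m J b (phi z) <= F)%MS.
    apply/row_subP => i.
    have [w [t e]] := JT z (delta_mx 0 i) Uz.
    have t0 : t = 0.
      apply/eqP; apply: contraT => t0; case: h; exists (delta_mx 0 i).
      have [s1 sn] := nu a b _ ch.
      rewrite e dphi// (ipDl (qP z Uz)) (ipZl (qP z Uz)).
      by rewrite [X in X + _]sn [X in _ * X]s1 add0r mulr1.
    rewrite row_mul rowE -dphi// e t0 scale0r addr0 dphi//.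
    exact: submxMl.
  have [K eK] := submxP FJ.
  have Ff : row_free F by have [_ h'] := hf; exact: h' ch.
  have K2 : K *m K = - 1%:M.
    apply: (row_free_inj Ff).
    rewrite -mulmxA -eK mulmxA -eK -mulmxA (acs_sq J bM (phiU _ Uz)).
    by rewrite mulmxN mulmx1 mulNmx mul1mx.
  apply: (no_odd_complex_structure _ K2).
  by rewrite -(hCR a b _ ch) /= odd_double.
- move=> z v Uz; rewrite dphi//.
  have := hpar a b _ (chartsU z Uz) v.
  rewrite /normal_connection /normal_part /shape_operator.
  rewrite mulNmx opprK => /eqP; rewrite subr_eq0 => /eqP <-.
  by rewrite /covariant_along /cov aK// -dphi.
- move=> z u v w Uz; have := hRA a b _ (chartsU z Uz) u v w.
  by rewrite aK.
- exact: orthogonal_vector (metricP gM Ux) (ltnW hn).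
Qed.
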